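(* Let $n\ge1$ and let $T$ be a good tree on the vertex set $[n+1]$. If the polynomial $P_n^{\mathcal{S}}(x_{ij})$ is a reduced form of the commutative monomial $m^{\mathcal{S}}[T]$, then $$P_n^{\mathcal{S}}(x_{ij}=1)=\sum_{m=0}^{n-1}f_{T,n-m}\,\beta^m,$$ where $f_{T,k}$ is the number of noncrossing alternating spanning forests $F$ of $\overline{T}$ with $k$ edges containing the edge $(1,n+1)$, at least one edge of the form $(i_1,j)$ with $i_1\le i$ for each right pseudo-component of $T$ on $[i,j]$, and at least one edge of the form $(i,j_1)$ with $j\le j_1$ for each left pseudo-component of $T$ on $[i,j]$.
   Context: Graphs have vertex set $[n+1]=\{1,\ldots,n+1\}$; an edge joining $i<j$ is written $(i,j)$, and $(i,j)_a$ is the edge $(i,j)$ with label $a$. A graph is noncrossing if there are no $i<j<k<l$ with $(i,k),(j,l)$ both edges; alternating if there are no $i<j<k$ with $(i,j),(j,k)$ both edges. The transitive closure $\overline{G}$ has as edges all $(i,j)$ for which there are edges $(i,i_1),(i_1,i_2),\ldots,(i_r,j)$ of $G$ with $i<i_1<\cdots<i_r<j$ (edges of $G$ included). A spanning forest of $\overline{T}$ is a forest with vertex set $[n+1]$ (isolated vertices allowed) with all edges in $\overline{T}$. A forest $H$ on $[n+1]$ with $k$ edges labeled $1,\ldots,k$ is good if: (i) if $(i,j)_a,(j,k)_b$ are edges, $i<j<k$, then $a<b$; (ii) if $(i,j)_a,(i,k)_b$ are edges with $i<j<k$, then $a>b$; (iii) if $(i,j)_a,(k,j)_b$ are edges with $i<k<j$,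 then $a>b$; (iv) $H$ is noncrossing. A good tree is a good forest that is a tree. Pseudo-components of a noncrossing tree $T$ (on a finite set of integers) are defined inductively. The simple path $P$ in $T$ from the smallest to the largest vertex of $T$ (from $1$ to $n+1$ when the vertex set is $[n+1]$) is a pseudo-component. The graph $T\setminus P$ (edges of $P$ removed) is an edge-disjoint union of trees $T_1,\ldots,T_k$ such that if $v$ is a vertex of $P$ and $v\in T_l$, then $v$ is either the minimal or the maximal vertex of $T_l$, and such that no $k-1$ trees with edge-disjoint union $T\setminus P$ satisfy these requirements. The set of pseudo-components is $ps(T)=\{P\}\cup ps(T_1)\cup\cdots\cup ps(T_k)$. A pseudo-component is on $[i,j]$, $i<j$, if it is a path with endpoints $i$ and $j$. A pseudo-component on $[i,j]$ is a left pseudo-component of $T$ if there is no edge $(s,i)\in E(T)$ with $s<i$, and a right pseudo-component of $T$ if there is no edge $(j,s)\in E(T)$ with $j<s$ (it may be both). $m^{\mathcal{S}}[T]=\prod_{(i,j)\in E(T)}x_{ij}$ in commuting variables $x_{ij}$, $1\le i<j\le n+1$. The reduction rule is $x_{ij}x_{jk}\to x_{ik}x_{ij}+x_{jk}x_{ik}+\beta x_{ik}$ for $i<j<k$ ($\beta$ a further variable), applied in one monomial of a polynomial at a time. A reduced form of a monomial is a polynomial obtained by successive applications of the rule until no monomial is divisible by any $x_{ij}x_{jk}$, $i<j<k$. *)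

(* Defs.v *)
From mathcomp Require Import all_boot all_order all_algebra.
From mathcomp Require Import boolp.
From mathcomp Require Import mpoly.
From Stdlib Require Import Relations.

Set Implicit Arguments.
Unset Strict Implicit.
Unset Printing Implicit Defensive.

Import GRing.Theory.

Local Open Scope ring_scope.

(** * Graphs on [n+1]

    The vertex v of [n+1] is the ordinal v-1 of 'I_n.+1. An edge is an ordered
    pair (i, j) with i < j, and a (simple) graph on [n+1] is its set of edges,
    so that isolated vertices are allowed. *)

Notation edge n := {e : 'I_n.+1 * 'I_n.+1 | (e.1 < e.2)%N}.
Notation graph n := {set edge n}.

Definition src n (e : edge n) : 'I_n.+1 := (val e).1.
Definition tgt n (e : edge n) : 'I_n.+1 := (val e).2.

(* [arc G i j]: i < j and (i, j) is an edge of G; [adj] is the undirected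
   adjacency relation of G. *)
Definition arc n (G : graph n) : rel 'I_n.+1 :=
  fun i j => [exists e in G, val e == (i, j)].
Definition adj n (G : graph n) : rel 'I_n.+1 :=
  fun i j => arc G i j || arc G j i.

(* The endpoints of the edges of G: the vertex set of G when G is regarded as
   a tree (with at least one edge) on a subset of [n+1]. *)
Definition vertices n (G : graph n) : {set 'I_n.+1} :=
  [set v | [exists w, adj G v w]].

Definition noncrossing n (G : graph n) : Prop :=
  forall i j k l : 'I_n.+1, (i < j)%N -> (j < k)%N -> (k < l)%N ->
    ~ (arc G i k /\ arc G j l).

Definition alternating n (G : graph n) : Prop :=
  forall i j k : 'I_n.+1, (i < j)%N -> (j < k)%N ->
    ~ (arc G i j /\ arc G j k).

(* A list of at most two vertices traverses at most one edge of G. *)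
Definition is_forest n (G : graph n) : Prop :=
  forall c : seq 'I_n.+1, ucycle (adj G) c -> (size c <= 2)%N.

Definition is_tree_on n (V : {set 'I_n.+1}) (G : graph n) : Prop :=
  [/\ vertices G \subset V,
      is_forest G &
      {in V &, forall i j, connect (adj G) i j}].

(* Edges go from left to right, so every arc-path from i to j is increasing;
   as [src e < tgt e], it has at least one edge. *)
Definition transitive_closure n (G : graph n) : graph n :=
  [set e | connect (arc G) (src e) (tgt e)].

(** * Good trees *)

Definition good_forest n (H : graph n) (lab : edge n -> nat) : Prop :=
  [/\ is_forest H,
      perm_eq [seq lab e | e in H] (iota 1 #|H|) &
      [/\ {in H &, forall e f, tgt e = src f -> (lab e < lab f)%N},
          {in H &, forall e f,
             src e = src f -> (tgt e < tgt f)%N -> (lab f < lab e)%N},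
          {in H &, forall e f,
             tgt e = tgt f -> (src e < src f)%N -> (lab f < lab e)%N} &
          noncrossing H]].

Definition good_tree n (T : graph n) (lab : edge n -> nat) : Prop :=
  good_forest T lab /\ is_tree_on [set: 'I_n.+1] T.

(** * Pseudo-components

    Trees on subsets of [n+1] and paths are given by their edge sets. *)

Definition smallest_vertex n (G : graph n) (v : 'I_n.+1) : Prop :=
  v \in vertices G /\ {in vertices G, forall w : 'I_n.+1, (v <= w)%N}.
Definition largest_vertex n (G : graph n) (v : 'I_n.+1) : Prop :=
  v \in vertices G /\ {in vertices G, forall w : 'I_n.+1, (w <= v)%N}.

Definition path_edges n (i : 'I_n.+1) (s : seq 'I_n.+1) : graph n :=
  [set e | ((src e, tgt e) \in zip (i :: s) s)
           || ((tgt e, src e) \in zip (i :: s) s)].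

(* P is the edge set of a simple path of G from i to j. *)
Definition is_path n (G : graph n) (i j : 'I_n.+1) (P : graph n) : Prop :=
  exists s : seq 'I_n.+1,
    [/\ path (adj G) i s, last i s = j, uniq (i :: s) & P = path_edges i s].

Definition spine n (T P : graph n) : Prop :=
  exists i j : 'I_n.+1,
    [/\ smallest_vertex T i, largest_vertex T j & is_path T i j P].

Definition attached_trees n (T P : graph n) (D : {set graph n}) : Prop :=
  partition D (T :\: P) /\
  {in D, forall B : graph n,
     is_tree_on (vertices B) B /\
     {in vertices P, forall v, v \in vertices B ->
        smallest_vertex B v \/ largest_vertex B v}}.

Definition pseudo_decomposition n (T P : graph n) (D : {set graph n})
    : Prop :=
  attached_trees T P D /\
  ~ (exists D' : {set graph n},
       attached_trees T P D' /\ (#|D'|.+1 = #|D|)%N).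

(* [pseudo_component T Q] : Q belongs to ps(T). *)
Inductive pseudo_component n : graph n -> graph n -> Prop :=
| pseudo_component_spine (T P : graph n) :
    spine T P -> pseudo_component T P
| pseudo_component_attached (T P : graph n) (D : {set graph n})
    (B Q : graph n) :
    spine T P -> pseudo_decomposition T P D -> B \in D ->
    pseudo_component B Q -> pseudo_component T Q.

Definition pseudo_component_on n (T : graph n) (i j : 'I_n.+1) : Prop :=
  (i < j)%N /\ exists2 Q, pseudo_component T Q & is_path T i j Q.

Definition left_pseudo_component_on n (T : graph n) (i j : 'I_n.+1) : Prop :=
  pseudo_component_on T i j /\ ~ (exists s, arc T s i).

Definition right_pseudo_component_on n (T : graph n) (i j : 'I_n.+1) : Prop :=
  pseudo_component_on T i j /\ ~ (exists s, arc T j s).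

(** * The numbers f_{T,k} *)

Definition counted_forest n (T : graph n) (k : nat) (F : graph n) : Prop :=
  [/\ [/\ is_forest F,
          F \subset transitive_closure T,
          noncrossing F & alternating F],
      #|F| = k,
      arc F ord0 ord_max,
      forall i j : 'I_n.+1, right_pseudo_component_on T i j ->
        exists i1 : 'I_n.+1, (i1 <= i)%N /\ arc F i1 j &
      forall i j : 'I_n.+1, left_pseudo_component_on T i j ->
        exists j1 : 'I_n.+1, (j <= j1)%N /\ arc F i j1].

Definition num_forests n (T : graph n) (k : nat) : nat :=
  #|[set F : graph n | `[< counted_forest T k F >]]|.

(** * Reduced forms

    Polynomials in commuting variables x_ij, i < j, over Z[beta]; the
    indeterminate 'X of {poly int} is beta. *)

Notation xpoly n := {mpoly {poly int}[#|{: edge n}|]}.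

Definition xvar n (e : edge n) : xpoly n := 'X_(enum_rank e).

Definition beta n : xpoly n := ('X : {poly int})%:MP.

Definition graph_monomial n (G : graph n) : xpoly n :=
  \prod_(e in G) xvar e.

(* eij = (i, j), ejk = (j, k) and eik = (i, k) for some i < j < k. *)
Definition reducible_triple n (eij ejk eik : edge n) : Prop :=
  [/\ tgt eij = src ejk, src eik = src eij & tgt eik = tgt ejk].

(* One application of the rule to a single occurrence of a monomial
   beta^a x_ij x_jk x^m of p. Rewriting a monomial together with its integer
   coefficient, or with its coefficient in Z[beta], is a succession of such
   steps. The coefficients stay nonnegative when one starts from a monomial,
   so [0 < _] only says that this monomial occurs in p. *)
Definition reduction_step n (p q : xpoly n) : Prop :=
  exists (a : nat) (m : 'X_{1..#|{: edge n}|}) (eij ejk eik : edge n),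
    [/\ reducible_triple eij ejk eik,
        0 < (p@_(U_(enum_rank eij) + U_(enum_rank ejk) + m)%MM)`_a &
        q = p - beta n ^+ a * (xvar eij * xvar ejk) * 'X_[m]
              + beta n ^+ a * (xvar eik * xvar eij + xvar ejk * xvar eik
                               + beta n * xvar eik) * 'X_[m]].

Definition irreducible_xpoly n (p : xpoly n) : Prop :=
  forall (eij ejk eik : edge n) (m : 'X_{1..#|{: edge n}|}),
    reducible_triple eij ejk eik -> m \in msupp p ->
    ~ (U_(enum_rank eij) + U_(enum_rank ejk) <= m)%MM.

Definition reduced_form n (p q : xpoly n) : Prop :=
  clos_refl_trans (xpoly n) (@reduction_step n) p q /\ irreducible_xpoly q.

(* Main.v *)
(* Send x_ij to the ray e_i - e_j of Z^(n+1). For a forest G with reducible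
   edges ij and jk, the lattice points in the relative interior of the cone of
   G are partitioned by the interiors of the cones of the three reduced graphs
   (compare the coefficients of e_i - e_j and e_j - e_k). Every reduced form of
   m[T] thus partitions the interior points of the cone of T among cones of
   alternating forests; the number of points of degree d in the interior of
   such a cone depends only on its number k of edges and is unitriangular in
   (k, d), so the numbers of forests with k edges in any partition of this kind
   agree.

   A second partition comes from parenthesis matching: each lattice point is
   uniquely a positive combination of the edges of a noncrossing alternating
   forest F. When T is noncrossing the point is interior to the cone of T iff F
   is contained in the transitive closure of T and every edge of T lies on the
   T-path joining the ends of some edge of F; the pseudo-components are the
   paths on which this covering condition has to be tested. *)

From Stdlib Require Import Relations.
From mathcomp Require Import mpoly.
From mathcomp Require Import all_boot all_order all_algebra.
From mathcomp Require Import boolp zify ring.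
Require Import Defs.

Set Implicit Arguments.
Unset Strict Implicit.
Unset Printing Implicit Defensive.

Import GRing.Theory.

Local Open Scope ring_scope.

(** Lattice points are not formed as vectors: a point is given by natural weights on edges, and two
    weights give the same point when their net flows agree. Interior points of the cone of [T]
    cannot be graded by their weights on [T], since straightening ij, jk to ik lowers the total
    weight. The degree is read off the noncrossing alternating weight of the point instead, where it
    is the sum of the positive parts of the flow; this makes the points of a given degree a finite
    set.

    Planarity does not survive an arbitrary sequence of reductions: the path 1-2-3-4 can be reduced
    to the edges 13, 23, 24, two of which cross. What is carried along is the linear independence of
    the incidence vectors over the integers. It passes to the three reduced graphs by eliminating
    one relation, and it makes the weight on a graph with a given flow unique, which is all that the
    subdivision of cones requires. *)

(** * Edges, arcs and adjacency *)

Lemma edge_inj n (e f : edge n) : src e = src f -> tgt e = tgt f -> e = f.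
Proof.
case: e f => [[a b] p] [[c d] q]; rewrite /src /tgt /= => h1 h2.
by apply/val_inj; rewrite /= h1 h2.
Qed.

Lemma edge_lt n (e : edge n) : (src e < tgt e)%N.
Proof. exact: (valP e). Qed.

Definition mkedge n (i j : 'I_n.+1) (h : (i < j)%N) : edge n :=
  exist (fun e : 'I_n.+1 * 'I_n.+1 => is_true (e.1 < e.2)%N) (i, j) h.

Lemma arcP n (G : graph n) i j :
  reflect (exists2 e, e \in G & src e = i /\ tgt e = j) (arc G i j).
Proof.
apply: (iffP existsP) => [[e /andP[eG /eqP he]]|[e eG [<- <-]]].
  by exists e; rewrite // /src /tgt he.
by exists e; rewrite eG /= /src /tgt -surjective_pairing.
Qed.

Lemma arc_edge n (G : graph n) e : e \in G -> arc G (src e) (tgt e).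
Proof. by move=> eG; apply/arcP; exists e. Qed.

Lemma arc_lt n (G : graph n) i j : arc G i j -> (i < j)%N.
Proof. by case/arcP=> e _ [<- <-]; apply: edge_lt. Qed.

Lemma arc_sub n (G H : graph n) : G \subset H -> subrel (arc G) (arc H).
Proof.
by move=> /subsetP GH i j /arcP[e /GH eH he]; apply/arcP; exists e.
Qed.

Lemma adj_sym n (G : graph n) : symmetric (adj G).
Proof. by move=> i j; rewrite /adj orbC. Qed.

Lemma connect_adj_sym n (G : graph n) : connect_sym (adj G).
Proof. exact: sym_connect_sym (@adj_sym n G). Qed.

Lemma adj_sub n (G H : graph n) : G \subset H -> subrel (adj G) (adj H).
Proof.
move=> GH i j /orP[] /(arc_sub GH) h; apply/orP; [by left|by right].
Qed.

Lemma adjP n (G : graph n) i j :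
  reflect (exists2 e, e \in G &
             (src e = i /\ tgt e = j) \/ (src e = j /\ tgt e = i)) (adj G i j).
Proof.
apply: (iffP orP) => [[] /arcP[e eG [h1 h2]]|[e eG [[<- <-]|[<- <-]]]].
- by exists e => //; left.
- by exists e => //; right.
- by left; apply: arc_edge.
- by right; apply: arc_edge.
Qed.

Lemma verticesP n (G : graph n) v :
  reflect (exists2 e, e \in G & src e = v \/ tgt e = v) (v \in vertices G).
Proof.
rewrite inE; apply: (iffP existsP) => [[w /adjP[e eG h]]|[e eG [] <-]].
- by exists e => //; case: h => [[]|[]]; [left|right].
- by exists (tgt e); apply/adjP; exists e => //; left.
- by exists (src e); apply/adjP; exists e => //; right.
Qed.

Lemma src_vertices n (G : graph n) e : e \in G -> src e \in vertices G.
Proof. by move=> eG; apply/verticesP; exists e; last left. Qed.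

Lemma tgt_vertices n (G : graph n) e : e \in G -> tgt e \in vertices G.
Proof. by move=> eG; apply/verticesP; exists e; last right. Qed.

Lemma vertices_sub n (G H : graph n) :
  G \subset H -> vertices G \subset vertices H.
Proof.
move=> /subsetP GH; apply/subsetP => v /verticesP[e /GH eH h].
by apply/verticesP; exists e.
Qed.

Lemma connect_arc_le n (G : graph n) i j : connect (arc G) i j -> (i <= j)%N.
Proof.
case/connectP=> s; elim: s i => [|a s IH] i /=; first by move=> _ ->.
by move=> /andP[/arc_lt ia /IH h] /h; apply: leq_trans (ltnW ia).
Qed.

Lemma connect_arc_last n (G : graph n) i j : connect (arc G) i j -> i != j ->
  exists2 k, connect (arc G) i k & arc G k j.
Proof.
case/connectP=> s; elim/last_ind: s j => [|s a _] j /=.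
  by move=> _ ->; rewrite eqxx.
rewrite rcons_path last_rcons => /andP[p q] -> _.
by exists (last i s) => //; apply/connectP; exists s.
Qed.

Lemma connect_arc_first n (G : graph n) i j : connect (arc G) i j -> i != j ->
  exists2 k, arc G i k & connect (arc G) k j.
Proof.
case/connectP=> [[|a s] /=]; first by move=> _ ->; rewrite eqxx.
by move=> /andP[p q] -> _; exists a => //; apply/connectP; exists s.
Qed.

Lemma connect_subrel (T : finType) (e e' : rel T) :
  subrel e e' -> subrel (connect e) (connect e').
Proof. by move=> h; apply: connect_sub => x y /h; apply: connect1. Qed.

(** * Net flows *)

Definition incidence n (R : comNzRingType) (e : edge n) (x : 'I_n.+1) : R :=
  (src e == x)%:R - (tgt e == x)%:R.

Definition netflow n (R : comNzRingType) (z : edge n -> R) (x : 'I_n.+1) : R :=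
  \sum_e z e * incidence R e x.

Definition independent n (R : comNzRingType) (G : graph n) :=
  forall z : edge n -> R, (forall e, e \notin G -> z e = 0) ->
    netflow z =1 (fun=> 0) -> forall e, z e = 0.

Lemma eq_netflow n (R : comNzRingType) (z z' : edge n -> R) :
  z =1 z' -> netflow z =1 netflow z'.
Proof. by move=> h x; apply: eq_bigr => e _; rewrite h. Qed.

Lemma netflowD n (R : comNzRingType) (z z' : edge n -> R) x :
  netflow (fun e => z e + z' e) x = netflow z x + netflow z' x.
Proof. by rewrite -big_split; apply: eq_bigr => e _; rewrite mulrDl. Qed.

Lemma netflowZ n (R : comNzRingType) a (z : edge n -> R) x :
  netflow (fun e => a * z e) x = a * netflow z x.
Proof. by rewrite mulr_sumr; apply: eq_bigr => e _; rewrite mulrA. Qed.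

Lemma netflowB n (R : comNzRingType) (z z' : edge n -> R) x :
  netflow (fun e => z e - z' e) x = netflow z x - netflow z' x.
Proof.
by rewrite -sumrB; apply: eq_bigr => e _; rewrite mulrBl.
Qed.

Lemma netflow0 n (R : comNzRingType) x :
  netflow (fun _ : edge n => 0 : R) x = 0.
Proof. by apply: big1 => e _; rewrite mul0r. Qed.

Lemma netflow1 n (R : comNzRingType) (f : edge n) x :
  netflow (fun e => (e == f)%:R) x = incidence R f x.
Proof.
rewrite /netflow (bigD1 f) //= eqxx mul1r big1 ?addr0 // => e /negPf ->.
by rewrite mul0r.
Qed.

(** A path between the ends that avoids [e] would close up with [e] to a cycle on at least three
    vertices; a path of a single step is excluded because an edge is determined by its ends. *)
Lemma forest_bridge n (G : graph n) e : is_forest G -> e \in G ->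
  ~~ connect (adj (G :\ e)) (src e) (tgt e).
Proof.
move=> fG eG; apply/negP => /connectP[s ps ls].
case: (shortenP ps) ls => t pt ut _ lt.
have sub : subrel (adj (G :\ e)) (adj G) by apply: adj_sub; apply: subD1set.
have hlast : last (src e) t != src e.
  by rewrite -lt; apply/eqP => h; have := edge_lt e; rewrite h ltnn.
have : (size (src e :: t) <= 2)%N.
  apply: fG; rewrite /ucycle ut andbT /= rcons_path (sub_path sub pt) /=.
  by rewrite -lt; apply/adjP; exists e => //; right.
case: t pt ut lt hlast => [|a [|b t]] //=; first by rewrite eqxx.
rewrite andbT => /adjP[f]; rewrite in_setD1 => /andP[/negP nfe _] h _ hea _.
move=> _; apply: nfe; apply/eqP; have := edge_lt f; have := edge_lt e.
rewrite hea; case: h => [[h1 h2]|[h1 h2]]; first by move=> _ _; apply: edge_inj; rewrite ?h1 ?h2.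
by rewrite h1 h2 => h3 h4; have := ltn_trans h3 h4; rewrite ltnn.
Qed.

(** A cut argument: [S] is the component of [src f] after removal of [f]. In the sum of the net flow
    over [S] every edge except [f] cancels, as only [f] leaves [S], so the sum is [z f]. *)
Lemma forest_independent n (R : comNzRingType) (G : graph n) :
  is_forest G -> independent R G.
Proof.
move=> fG z zG bz f; have [fGin|/zG //] := boolP (f \in G).
have hb := forest_bridge fG fGin.
pose S := [set x | connect (adj (G :\ f)) (src f) x].
have: \sum_(x in S) netflow z x = 0 by apply: big1 => x _; apply: bz.
rewrite exchange_big /= (bigD1 f) //= [X in _ + X]big1 => [|e ne].
  rewrite addr0 -mulr_sumr sumrB (bigD1 (src f)) /=; last first.
    by rewrite inE.
  rewrite eqxx big1 => [|x /andP[_ /negPf]]; last by rewrite eq_sym => ->.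
  rewrite big1 => [|x]; first by rewrite addr0 subr0 mulr1.
  rewrite inE => hx; case: eqP => // hx'; by rewrite -hx' (negPf hb) in hx.
have [eG|/zG ->] := boolP (e \in G); last by apply: big1 => x _; rewrite mul0r.
rewrite -mulr_sumr sumrB.
have delta (v : 'I_n.+1) : \sum_(x in S) (v == x)%:R = (v \in S)%:R :> R.
  have [vS|vS] := boolP (v \in S).
    rewrite (bigD1 v) //= eqxx big1 ?addr0 // => x /andP[_ /negPf].
    by rewrite eq_sym => ->.
  by apply: big1 => x xS; case: eqP => // vx; rewrite vx xS in vS.
rewrite !delta.
suff -> : (src e \in S) = (tgt e \in S) by rewrite subrr mulr0.
rewrite !inE; apply: (@same_connect_r _ _ (@connect_adj_sym _ _)).
by apply: connect1; apply/adjP; exists e; [rewrite !inE ne|left].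
Qed.

Lemma independent_eq n (R : comNzRingType) (G : graph n) (z z' : edge n -> R) :
  independent R G -> (forall e, e \notin G -> z e = 0) ->
  (forall e, e \notin G -> z' e = 0) -> netflow z =1 netflow z' -> z =1 z'.
Proof.
move=> iG hz hz' hb e; apply/eqP; rewrite -subr_eq0; apply/eqP.
apply: (iG (fun e => z e - z' e)) => [f fG|x].
  by rewrite hz // hz' // subrr.
by rewrite netflowB hb subrr.
Qed.

Lemma connect_flow n (R : comNzRingType) (G : graph n) a b :
  connect (adj G) a b ->
  exists2 z : edge n -> R, (forall e, e \notin G -> z e = 0) &
    forall x, netflow z x = (a == x)%:R - (b == x)%:R.
Proof.
case/connectP=> s; elim: s a => [|c s IH] a /=.
  by move=> _ ->; exists (fun=> 0) => // x; rewrite netflow0 subrr.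
case/andP=> /adjP[f fG h] /IH{}IH /IH[z zG bz].
(* The walk may traverse [f] against its orientation; [eps] is the sign of the traversal. *)
pose eps : R := if src f == a then 1 else -1.
exists (fun e => z e + eps * (e == f)%:R) => [e eG|x].
  rewrite zG //; case: eqP => [ef|_]; last by rewrite mulr0 addr0.
  by rewrite ef fG in eG.
rewrite netflowD netflowZ netflow1 bz /incidence /eps.
case: h => [[<- <-]|[<- <-]]; first by rewrite eqxx; ring.
have -> : (src f == tgt f) = false by rewrite -val_eqE /= (ltn_eqF (edge_lt f)).
ring.
Qed.

(* The two paths would form a cycle. *)
Lemma connect_disjoint n (T G H : graph n) a b : independent int T ->
  G \subset T -> H \subset T -> [disjoint G & H] ->
  connect (adj G) a b -> connect (adj H) a b -> a = b.
Proof.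
move=> iT /subsetP GT /subsetP HT GH /(connect_flow int)[z zG bz]
  /(connect_flow int)[z' zH bz'].
have h : z =1 z'.
  apply: (independent_eq iT) => [e eT|e eT|x]; last by rewrite bz bz'.
    by apply: zG; apply: contra eT; apply: GT.
  by apply: zH; apply: contra eT; apply: HT.
have z0 e : z e = 0.
  have [eG|/zG //] := boolP (e \in G).
  by rewrite h; apply: zH; rewrite (disjointFr GH eG).
have := bz a; rewrite (eq_netflow z0) netflow0 eqxx.
by case: eqP => [->|_] //; rewrite subr0.
Qed.

(** * Noncrossing alternating representatives *)

Definition natflow n (w : edge n -> nat) : 'I_n.+1 -> int :=
  netflow (fun e => (w e)%:R : int).

Definition support n (w : edge n -> nat) : graph n := [set e | (0 < w e)%N].

Definition outflow n (w : edge n -> nat) (x : 'I_n.+1) : nat :=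
  \sum_(e | src e == x) w e.

Definition inflow n (w : edge n -> nat) (x : 'I_n.+1) : nat :=
  \sum_(e | tgt e == x) w e.

Lemma eq_natflow n (w w' : edge n -> nat) : w =1 w' -> natflow w =1 natflow w'.
Proof. by move=> h; apply: eq_netflow => e; rewrite h. Qed.

Lemma eq_support n (w w' : edge n -> nat) : w =1 w' -> support w = support w'.
Proof. by move=> h; apply/setP => e; rewrite !inE h. Qed.

Lemma notin_support n (w : edge n -> nat) e : e \notin support w -> w e = 0%N.
Proof. by rewrite inE -eqn0Ngt => /eqP. Qed.

Lemma natflowE n (w : edge n -> nat) x :
  natflow w x = (outflow w x)%:R - (inflow w x)%:R.
Proof.
rewrite /natflow /netflow /incidence /outflow /inflow !natr_sum.
rewrite [X in _ = X - _]big_mkcond [X in _ = _ - X]big_mkcond /= -sumrB.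
apply: eq_bigr => e _.
by case: ifP => _; case: ifP => _; rewrite /= ?mulr1n ?mulr0n; ring.
Qed.

Lemma natflowD n (w w' : edge n -> nat) x :
  natflow (fun e => w e + w' e)%N x = natflow w x + natflow w' x.
Proof. by rewrite -netflowD; apply: eq_netflow => e; rewrite natrD. Qed.

Lemma natflow1 n (f : edge n) x :
  natflow (fun e => (e == f) : nat) x = incidence int f x.
Proof. exact: netflow1. Qed.

Lemma outflow_gt0 n (w : edge n -> nat) x :
  reflect (exists2 e, e \in support w & src e = x) (0 < outflow w x)%N.
Proof.
rewrite lt0n sum_nat_eq0 negb_forall; apply: (iffP existsP) => [[e]|[e es <-]].
  rewrite negb_imply => /andP[/eqP h1 h2]; exists e => //.
  by rewrite inE lt0n.
by exists e; rewrite eqxx /= -lt0n; rewrite inE in es.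
Qed.

Lemma inflow_gt0 n (w : edge n -> nat) x :
  reflect (exists2 e, e \in support w & tgt e = x) (0 < inflow w x)%N.
Proof.
rewrite lt0n sum_nat_eq0 negb_forall; apply: (iffP existsP) => [[e]|[e es <-]].
  rewrite negb_imply => /andP[/eqP h1 h2]; exists e => //.
  by rewrite inE lt0n.
by exists e; rewrite eqxx /= -lt0n; rewrite inE in es.
Qed.

Lemma alternating_edges n (G : graph n) : alternating G <->
  {in G &, forall e f, tgt e <> src f}.
Proof.
split=> [aG e f eG fG h|aG i j k ij jk [/arcP[e eG [he1 he2]] /arcP[f fG [hf1 _]]]].
  apply: (aG (src e) (tgt e) (tgt f)); [exact: edge_lt| |split].
  - by rewrite h edge_lt.
  - exact: arc_edge.
  - by rewrite h; apply: arc_edge.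
by apply: (aG e f eG fG); rewrite he2 hf1.
Qed.

Lemma noncrossing_edges n (G : graph n) : noncrossing G <->
  {in G &, forall e f, ~ [/\ (src e < src f)%N, (src f < tgt e)%N
                           & (tgt e < tgt f)%N]}.
Proof.
split=> [aG e f eG fG [h1 h2 h3]|aG i j k l ij jk kl
         [/arcP[e eG [he1 he2]] /arcP[f fG [hf1 hf2]]]].
  by apply: (aG _ _ _ _ h1 h2 h3); split; apply: arc_edge.
by apply: (aG e f eG fG); rewrite he1 he2 hf1 hf2.
Qed.

Lemma alternating_flow n (w : edge n -> nat) x : alternating (support w) ->
  (outflow w x == 0)%N || (inflow w x == 0)%N.
Proof.
move=> /alternating_edges aw; rewrite !eqn0Ngt -negb_and.
apply/negP => /andP[/outflow_gt0[e eG <-] /inflow_gt0[f fG h]].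
exact: (aw f e).
Qed.

(** No vertex of an alternating graph has both incoming and outgoing edges, so outflow and inflow
    are the positive and negative parts of the flow. *)
Lemma alternating_flow_eq n (w w' : edge n -> nat) x :
  alternating (support w) -> alternating (support w') ->
  natflow w x = natflow w' x ->
  outflow w x = outflow w' x /\ inflow w x = inflow w' x.
Proof.
move=> /(@alternating_flow _ _ x) a /(@alternating_flow _ _ x) a'.
rewrite !natflowE; lia.
Qed.

Lemma total_outflow n (w : edge n -> nat) :
  (\sum_e w e = \sum_x outflow w x)%N.
Proof.
exact: (partition_big (@src n) xpredT).
Qed.

(** An innermost pair of parentheses must be matched: if [e] were missing, the edge leaving [src e]
    would end beyond [tgt e], the edge entering [tgt e] would start before [src e], and the two
    would cross. *)
Lemma noncrossing_shortest n (B : graph n) e : noncrossing B ->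
  (exists2 f, f \in B & src f = src e) -> (exists2 f, f \in B & tgt f = tgt e) ->
  {in B, forall f, (tgt e - src e <= tgt f - src f)%N} -> e \in B.
Proof.
move=> /noncrossing_edges nB [f fB sf] [g gB tg] short.
have := short f fB; have := short g gB; rewrite sf tg => hg hf.
have le := edge_lt e; have lf := edge_lt f; have lg := edge_lt g.
rewrite sf in lf; rewrite tg in lg.
have [h|h] := eqVneq (tgt f) (tgt e); first by rewrite -(edge_inj sf h).
have [h'|h'] := eqVneq (src g) (src e); first by rewrite -(edge_inj h' tg).
case: (nB g f gB fB); rewrite sf tg; rewrite -val_eqE /= in h; rewrite -val_eqE /= in h'; split; lia.
Qed.

Lemma support_decr n (w : edge n -> nat) e :
  support (fun f => w f - (f == e))%N \subset support w.
Proof. by apply/subsetP => f; rewrite !inE; lia. Qed.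

Lemma alternating_sub n (G H : graph n) :
  G \subset H -> alternating H -> alternating G.
Proof.
move=> /arc_sub s aH i j k ij jk [/s h1 /s h2].
exact: (aH i j k).
Qed.

Lemma noncrossing_sub n (G H : graph n) :
  G \subset H -> noncrossing H -> noncrossing G.
Proof.
move=> /arc_sub s aH i j k l ij jk kl [/s h1 /s h2].
exact: (aH i j k l).
Qed.

Lemma decrK n (w : edge n -> nat) e : e \in support w ->
  w =1 (fun f => (w f - (f == e)) + (f == e))%N.
Proof.
by rewrite inE => we f; case: eqP => [->|_]; rewrite ?subnK // subn0 addn0.
Qed.

(* A noncrossing alternating multigraph is a parenthesis matching: its
   opening and closing parentheses are given by the sign of the flow. *)
Lemma noncrossing_alternating_unique n (w w' : edge n -> nat) :
  noncrossing (support w) -> alternating (support w) ->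
  noncrossing (support w') -> alternating (support w') ->
  natflow w =1 natflow w' -> w =1 w'.
Proof.
have [m] := ubnP (\sum_e w e)%N; elim: m w w' => // m IH w w' le_m nw aw nw' aw' h.
have [h0|[e0 e0U]] := set_0Vmem (support w :|: support w').
  move=> e; have : e \notin support w :|: support w' by rewrite h0 inE.
  by rewrite inE negb_or => /andP[/notin_support -> /notin_support ->].
(* A shortest edge of either support lies in both, so one copy of it can be removed from both
   weights. *)
pose len (e : edge n) := (tgt e - src e)%N.
case: (arg_minnP len e0U) => e eU min_e.
have {}eU : e \in support w :|: support w' by [].
have emin : {in support w :|: support w', forall f, (len e <= len f)%N}.
  by move=> f; apply: min_e.
have flows x : outflow w x = outflow w' x /\ inflow w x = inflow w' x.
  exact: alternating_flow_eq.
have [ew ew'] : e \in support w /\ e \in support w'.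
  case/setUP: (eU) => eU'.
    split=> //; apply: noncrossing_shortest => //.
    - by apply/(outflow_gt0 w'); rewrite -(flows _).1; apply/(outflow_gt0 w); exists e.
    - by apply/(inflow_gt0 w'); rewrite -(flows _).2; apply/(inflow_gt0 w); exists e.
    - by move=> f fw; apply: emin; rewrite inE fw orbT.
  split=> //; apply: noncrossing_shortest => //.
  - by apply/(outflow_gt0 w); rewrite (flows _).1; apply/(outflow_gt0 w'); exists e.
  - by apply/(inflow_gt0 w); rewrite (flows _).2; apply/(inflow_gt0 w'); exists e.
  - by move=> f fw; apply: emin; rewrite inE fw.
have IH' : (fun f => w f - (f == e))%N =1 (fun f => w' f - (f == e))%N.
  apply: IH.
  - move: le_m; rewrite (eq_bigr _ (fun f _ => decrK ew f)) big_split /=.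
    by rewrite [X in (_ + X)%N](bigD1 e) //= eqxx; lia.
  - exact: noncrossing_sub (support_decr _ _) nw.
  - exact: alternating_sub (support_decr _ _) aw.
  - exact: noncrossing_sub (support_decr _ _) nw'.
  - exact: alternating_sub (support_decr _ _) aw'.
  - move=> x; have := h x; rewrite (eq_natflow (decrK ew)) (eq_natflow (decrK ew')).
    by rewrite !natflowD => /addIr.
by move=> f; rewrite (decrK ew) (decrK ew') IH'.
Qed.

(** Room for straightening and uncrossing. It is used for the complete graph and for the transitive
    closure of a noncrossing graph. *)
Definition closed_under_uncrossing n (C : graph n) :=
  (forall i j k, arc C i j -> arc C j k -> arc C i k) /\
  (forall i j k l : 'I_n.+1, (i < j)%N -> (j < k)%N -> (k < l)%N ->
     arc C i k -> arc C j l -> arc C j k /\ arc C i l).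

(** Uncrossing preserves the number of edges and their total length, so lengths enter squared: when
    lengths p+q and q+r become q and p+q+r, the sum of squares grows by 2pr. The constant n^2 bounds
    every square, so the subtraction is never truncated, and it makes the loss of an edge in
    straightening a decrease. *)
Definition energy n (w : edge n -> nat) : nat :=
  \sum_e w e * (n ^ 2 - (tgt e - src e) ^ 2).

Lemma energyD n (w w' : edge n -> nat) :
  energy (fun e => w e + w' e)%N = (energy w + energy w')%N.
Proof. by rewrite -big_split; apply: eq_bigr => e _; rewrite mulnDl. Qed.

Lemma energy1 n (f : edge n) :
  energy (fun e => (e == f) : nat) = (n ^ 2 - (tgt f - src f) ^ 2)%N.
Proof.
rewrite /energy (bigD1 f) //= eqxx mul1n big1 ?addn0 // => e /negPf ->.
by rewrite mul0n.
Qed.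

Lemma eq_energy n (w w' : edge n -> nat) : w =1 w' -> energy w = energy w'.
Proof. by move=> h; apply: eq_bigr => e _; rewrite h. Qed.

Lemma square_uncross n a b c d : (a < b)%N -> (b < c)%N -> (c < d)%N ->
  (d <= n)%N ->
  ((n ^ 2 - (c - b) ^ 2) + (n ^ 2 - (d - a) ^ 2) <
   (n ^ 2 - (c - a) ^ 2) + (n ^ 2 - (d - b) ^ 2))%N.
Proof.
move=> ab bc cd dn.
have da : ((d - a) ^ 2 <= n ^ 2)%N by rewrite leq_exp2r //; lia.
have : exists p q r, [/\ (b = a + p)%N,
    (c = a + p + q)%N, (d = a + p + q + r)%N, (0 < p)%N & (0 < r)%N].
  by exists (b - a)%N, (c - b)%N, (d - c)%N; split; lia.
case=> p [q [r [hb hc hd p0 r0]]]; subst b c d.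
have pr : (0 < p * r)%N by rewrite muln_gt0 p0 r0.
move: da.
have -> : (a + p + q - (a + p) = q)%N by lia.
have -> : (a + p + q + r - (a + p) = q + r)%N by lia.
have -> : (a + p + q - a = p + q)%N by lia.
have -> : (a + p + q + r - a = p + q + r)%N by lia.
rewrite -!mulnn !mulnDl !mulnDr; move: (n * n)%N; clear -pr => m.
rewrite (mulnC q p) (mulnC r p) (mulnC r q).
by move: (p * p)%N (p * q)%N (p * r)%N (q * q)%N (q * r)%N (r * r)%N pr; lia.
Qed.

Lemma square_straighten n a b c : (a < b)%N -> (b < c)%N -> (c <= n)%N ->
  (n ^ 2 - (c - a) ^ 2 < (n ^ 2 - (b - a) ^ 2) + (n ^ 2 - (c - b) ^ 2))%N.
Proof.
move=> ab bc cn.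
have da : ((c - a) ^ 2 <= n ^ 2)%N by rewrite leq_exp2r //; lia.
have : exists p q, [/\ (b = a + p)%N, (c = a + p + q)%N, (0 < p)%N & (0 < q)%N].
  by exists (b - a)%N, (c - b)%N; split; lia.
case=> p [q [hb hc p0 q0]]; subst b c.
have pq : (0 < p * q)%N by rewrite muln_gt0 p0 q0.
move: da.
have -> : (a + p + q - (a + p) = q)%N by lia.
have -> : (a + p + q - a = p + q)%N by lia.
have -> : (a + p - a = p)%N by lia.
rewrite -!mulnn !mulnDl !mulnDr; move: (n * n)%N; clear -pq => m.
rewrite (mulnC q p).
by move: (p * p)%N (p * q)%N (q * q)%N pq; lia.
Qed.

(* Straightening x_ij x_jk to x_ik and x_ik x_jl to x_jk x_il lowers the
   energy. *)
Lemma noncrossing_alternating_exists n (C : graph n) (w : edge n -> nat) :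
  closed_under_uncrossing C -> support w \subset C ->
  exists u : edge n -> nat,
    [/\ support u \subset C, noncrossing (support u), alternating (support u)
      & natflow u =1 natflow w].
Proof.
move=> [trC crC]; have [m] := ubnP (energy w).
elim: m w => // m IH w le_m wC.
have split2 e f : e \in support w -> f \in support w -> e != f ->
    exists2 w0 : edge n -> nat, w =1 (fun g => w0 g + (g == e) + (g == f))%N
      & support w0 \subset C.
  rewrite !inE => we wf ef; exists (fun g => w g - (g == e) - (g == f))%N.
    by move=> g; case: (eqVneq g e) => [->|_]; [rewrite (negPf ef)|case: eqP => [->|]]; lia.
  by apply: subset_trans wC; apply/subsetP => g; rewrite !inE; lia.
have size_edge (e : edge n) : (tgt e <= n)%N by have := ltn_ord (tgt e).
have [nw|] := pselect (noncrossing (support w)); last first.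
  move=> /noncrossing_edges/existsNP[e] /existsNP[f] /not_implyP[ew].
  move=> /not_implyP[fw] /contrapT[h1 h2 h3].
  have ef : e != f by apply: contraTneq h1 => ->; rewrite ltnn.
  have [w0 hw w0C] := split2 e f ew fw ef.
  have /= [/arcP[g gC [g1 g2]] /arcP[h hC [hh1 hh2]]] := crC _ _ _ _ h1 h2 h3
    (arc_edge (subsetP wC _ ew)) (arc_edge (subsetP wC _ fw)).
  have [||u [uC nu au bu]] := IH (fun d => w0 d + (d == g) + (d == h))%N.
  - move: le_m; rewrite (eq_energy hw) !energyD !energy1 g1 g2 hh1 hh2.
    rewrite ltnS -!addnA; apply: leq_trans; rewrite ltn_add2l.
    exact: square_uncross.
  - apply/subsetP => d; rewrite inE; case: (eqVneq d g) => [->//|_].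
    case: (eqVneq d h) => [->//|_]; rewrite !addn0 => hd.
    by apply: (subsetP w0C); rewrite inE.
  exists u; split => // x; rewrite bu (eq_natflow hw) !natflowD !natflow1.
  by rewrite /incidence g1 g2 hh1 hh2; ring.
have [aw|] := pselect (alternating (support w)).
  by exists w.
move=> /alternating_edges/existsNP[e] /existsNP[f] /not_implyP[ew].
move=> /not_implyP[fw] /contrapT h.
have ef : e != f.
  by apply/eqP => ef; have := edge_lt e; rewrite {1}ef -h ltnn.
have [w0 hw w0C] := split2 e f ew fw ef.
have /arcP[g gC [g1 g2]] : arc C (src e) (tgt f).
  apply: (trC _ (tgt e)); first exact: arc_edge (subsetP wC _ ew).
  by rewrite h; apply: arc_edge (subsetP wC _ fw).
have [||u [uC nu au bu]] := IH (fun d => w0 d + (d == g))%N.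
- move: le_m; rewrite (eq_energy hw) !energyD !energy1 g1 g2 -h.
  rewrite ltnS -!addnA; apply: leq_trans; rewrite ltn_add2l.
  by apply: square_straighten; rewrite ?edge_lt // h edge_lt.
- apply/subsetP => d; rewrite inE; case: (eqVneq d g) => [->//|_].
  rewrite !addn0 => hd.
  by apply: (subsetP w0C); rewrite inE.
exists u; split => // x; rewrite bu (eq_natflow hw) !natflowD !natflow1.
by rewrite /incidence g1 g2 h; ring.
Qed.

(** * Interior flows of a noncrossing tree *)

Definition covers n (T : graph n) (f e : edge n) :=
  connect (arc T) (src f) (src e) /\ connect (arc T) (tgt e) (tgt f).

(* The flow of u lies in the relative interior of the cone spanned by the
   vectors of the edges of G. *)
Definition interior n (G : graph n) (u : edge n -> nat) : Prop :=
  exists2 w : edge n -> nat, support w = G & natflow w =1 natflow u.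

Lemma independent_natflow n (G : graph n) (w w' : edge n -> nat) :
  independent int G -> support w \subset G -> support w' \subset G ->
  natflow w =1 natflow w' -> w =1 w'.
Proof.
move=> iG /subsetP wG /subsetP wG' h e.
have zero (v : edge n -> nat) : {subset support v <= G} ->
    forall f, f \notin G -> (v f)%:R = 0 :> int.
  by move=> vG f fG; rewrite notin_support //; apply: contra fG; apply: vG.
have := independent_eq iG (zero _ wG) (zero _ wG') h e.
by rewrite !natz => -[].
Qed.

Lemma transitive_closureP n (T : graph n) (i j : 'I_n.+1) :
  reflect ((i < j)%N /\ connect (arc T) i j) (arc (transitive_closure T) i j).
Proof.
apply: (iffP (arcP _ _ _)) => [[e]|[ij h]].
  by rewrite inE => h [<- <-]; rewrite edge_lt.
by exists (mkedge ij); rewrite ?inE.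
Qed.

Lemma connect_straddle n (G : graph n) (i j k : 'I_n.+1) :
  connect (arc G) i k -> (i <= j)%N -> (j < k)%N ->
  exists x y, [/\ arc G x y, (x <= j < y)%N, connect (arc G) i x
                & connect (arc G) y k].
Proof.
case/connectP=> s; elim: s i => [|a s IH] i /=.
  by move=> _ -> ij jk; have := leq_ltn_trans ij jk; rewrite ltnn.
case/andP=> ia ps ls ij jk; have [aj|ja] := leqP a j.
  have [x [y [xy h c1 c2]]] := IH a ps ls aj jk.
  by exists x, y; split => //; apply: connect_trans c1; apply: connect1.
exists i, a; split=> //; [by rewrite ij ja|].
by apply/connectP; exists s.
Qed.

(** A step of the path that jumped over [b] would cross the arc from [a] to [b], so the path visits
    [b]. *)
Lemma connect_exit n (T : graph n) (a b j l : 'I_n.+1) : noncrossing T ->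
  arc T a b -> (a < j)%N -> (j <= b)%N -> (b <= l)%N -> connect (arc T) j l ->
  connect (arc T) j b /\ connect (arc T) b l.
Proof.
move=> nT ab aj jb bl /connectP[s]; elim: s j aj jb => [|c s IH] j aj jb /=.
  move=> _ lj; have -> : l = b by apply/val_inj/eqP; rewrite eqn_leq bl lj jb.
  have -> : j = b by apply/val_inj/eqP; rewrite eqn_leq jb -lj bl.
  by rewrite !connect0.
case/andP=> jc ps ls; have [ejb|nejb] := eqVneq j b.
  rewrite -ejb connect0; split=> //.
  by apply/connectP; exists (c :: s); rewrite //= jc.
have ltjb : (j < b)%N by rewrite ltn_neqAle jb andbT.
have cb : (c <= b)%N.
  by rewrite leqNgt; apply/negP => bc; apply: (nT _ _ _ _ aj ltjb bc).
have [h1 h2] := IH c (ltn_trans aj (arc_lt jc)) cb ps ls.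
by split=> //; apply: connect_trans h1; apply: connect1.
Qed.

(** The paths from [i] to [k] and from [j] to [l] share a vertex: the arc of the first that passes
    over [j] confines the second up to the right end [y] of that arc, where the two paths can be
    exchanged. If the arc starts at [j], then [j] itself is shared. *)
Lemma transitive_closure_uncrossing n (T : graph n) : noncrossing T ->
  closed_under_uncrossing (transitive_closure T).
Proof.
move=> nT; split=> [i j k|i j k l ij jk kl].
  move=> /transitive_closureP[ij cij] /transitive_closureP[jk cjk].
  apply/transitive_closureP; split; first exact: ltn_trans jk.
  exact: connect_trans cjk.
move=> /transitive_closureP[ik cik] /transitive_closureP[jl cjl].
suff [h1 h2] : connect (arc T) j k /\ connect (arc T) i l.
  by split; apply/transitive_closureP; split=> //; apply: ltn_trans jl.
have [x [y [xy /andP[xj jy] cix cyk]]] := connect_straddle cik (ltnW ij) jk.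
have [exj|nexj] := eqVneq x j.
  rewrite exj in cix xy; split; last exact: connect_trans cjl.
  by apply: connect_trans cyk; apply: connect1.
have {xj nexj}xj : (x < j)%N by rewrite ltn_neqAle xj andbT.
have yl : (y <= l)%N := leq_trans (connect_arc_le cyk) (ltnW kl).
have [cjy cyl] := connect_exit nT xy xj (ltnW jy) yl cjl.
split; first exact: connect_trans cyk.
by apply: connect_trans cix _; apply: connect_trans cyl; apply: connect1.
Qed.

Lemma connect_natflow n (T : graph n) a b : connect (arc T) a b ->
  exists w : edge n -> nat, [/\ support w \subset T,
    (forall x, natflow w x = (a == x)%:R - (b == x)%:R) &
    {in support w, forall e,
       connect (arc T) a (src e) /\ connect (arc T) (tgt e) b}].
Proof.
case/connectP=> s; elim: s a => [|c s IH] a /=.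
  move=> _ ->; exists (fun=> 0%N); split=> [|x|e].
  - by apply/subsetP => e; rewrite inE.
  - by rewrite subrr; apply: netflow0.
  - by rewrite inE.
case/andP=> ac ps ls; have [w [wT bw cw]] := IH c ps ls.
have [f fT [fa fc]] := arcP _ _ _ ac.
exists (fun e => w e + (e == f))%N; split=> [|x|e].
- apply/subsetP => e; rewrite inE; case: (eqVneq e f) => [->//|_].
  by rewrite addn0 => we; apply: (subsetP wT); rewrite inE.
- by rewrite natflowD natflow1 bw /incidence fa fc; ring.
- rewrite inE; case: (eqVneq e f) => [-> _|_].
    by rewrite fa fc connect0; split=> //; apply/connectP; exists s.
  rewrite addn0 => we; have [|h1 h2] := cw e; first by rewrite inE.
  by split=> //; apply: connect_trans h1; apply: connect1.
Qed.

Lemma edge_natflow n (T : graph n) f : independent int T ->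
  f \in transitive_closure T ->
  exists w : edge n -> nat, [/\ support w \subset T,
    natflow w =1 incidence int f & {in T, forall e, (0 < w e)%N <-> covers T f e}].
Proof.
move=> iT; rewrite inE => /connect_natflow[w [wT bw cw]].
exists w; split=> // e eT; split=> [we|[h1 h2]].
  by apply: cw; rewrite inE.
have [w1 [wT1 bw1 _]] := connect_natflow h1.
have [w2 [wT2 bw2 _]] := connect_natflow h2.
(* If [e] is covered, the path from [src f] through [e] to [tgt f] carries the same flow as [w], so
   independence identifies the two weights. *)
have -> : w e = (w1 e + w2 e + (e == e))%N.
  apply: (independent_natflow (w' := fun g => (w1 g + w2 g + (g == e))%N) iT wT).
    apply/subsetP => g; rewrite inE; case: (eqVneq g e) => [->//|_].
    rewrite addn0 addn_gt0 => /orP[] h.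
      by apply: (subsetP wT1); rewrite inE.
    by apply: (subsetP wT2); rewrite inE.
  by move=> x; rewrite !natflowD natflow1 bw bw1 bw2 /incidence; ring.
by rewrite eqxx addn1.
Qed.

(** Each edge of [u] is replaced by its path in [T]. The path weights are nonnegative, so nothing
    cancels and positivity at [e] means being covered. *)
Lemma natflow_pushdown n (T : graph n) (u : edge n -> nat) : independent int T ->
  support u \subset transitive_closure T ->
  exists w : edge n -> nat, [/\ support w \subset T, natflow w =1 natflow u &
    {in T, forall e, (0 < w e)%N <-> exists2 f, f \in support u & covers T f e}].
Proof.
move=> iT /subsetP uT.
have /choice[W hW] f : exists w : edge n -> nat, f \in transitive_closure T ->
    [/\ support w \subset T, natflow w =1 incidence int f
      & {in T, forall e, (0 < w e)%N <-> covers T f e}].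
  have [fT|fT] := boolP (f \in transitive_closure T); last by exists (fun=> 0%N).
  by have [w hw] := edge_natflow iT fT; exists w.
exists (fun e => \sum_f u f * W f e)%N; split.
- apply/subsetP => e; rewrite inE lt0n sum_nat_eq0 negb_forall => /existsP[f].
  rewrite /= muln_eq0 negb_or -!lt0n => /andP[uf Wf].
  have [|/subsetP h _ _] := hW f; first by apply: uT; rewrite inE.
  by apply: h; rewrite inE.
- move=> x; rewrite /natflow /netflow.
  transitivity (\sum_e \sum_f (u f)%:R * ((W f e)%:R * incidence int e x)).
    apply: eq_bigr => e _; rewrite natr_sum mulr_suml.
    by apply: eq_bigr => f _; rewrite natrM mulrA.
  rewrite exchange_big; apply: eq_bigr => f _; rewrite -mulr_sumr.
  have [uf|uf] := boolP (f \in support u); last by rewrite notin_support // !mul0r.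
  by have [_ h _] := hW f (uT _ uf); rewrite -h.
- move=> e eT; rewrite lt0n sum_nat_eq0 negb_forall; split.
    case/existsP=> f; rewrite /= muln_eq0 negb_or -!lt0n => /andP[uf Wf].
    have fu : f \in support u by rewrite inE.
    by exists f => //; have [_ _ h] := hW f (uT _ fu); apply/h.
  move=> [f fu cf]; apply/existsP; exists f.
  rewrite /= muln_eq0 negb_or -!lt0n; have [_ _ h] := hW f (uT _ fu).
  by apply/andP; split; [rewrite inE in fu|apply/h].
Qed.

(** If [w] has support [T] and the flow of [u], then straightening and uncrossing [w] inside the
    transitive closure ends in [u] by uniqueness, and pushing [u] down returns [w] by independence.
    Hence the edges covered by [u] are those where [w] is positive, that is, all of [T]. *)
Lemma interior_covered n (T : graph n) (u : edge n -> nat) :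
  noncrossing T -> independent int T ->
  noncrossing (support u) -> alternating (support u) ->
  interior T u <-> support u \subset transitive_closure T /\
    {in T, forall e, exists2 f, f \in support u & covers T f e}.
Proof.
move=> nT iT nu au; split=> [[w wT bw]|[uT cT]].
  have wsub : support w \subset transitive_closure T.
    rewrite wT; apply/subsetP => e eT; rewrite inE.
    by apply: connect1; apply: arc_edge.
  have [u' [uT' nu' au' bu']] :=
    noncrossing_alternating_exists (transitive_closure_uncrossing nT) wsub.
  have uu' : u =1 u'.
    by apply: noncrossing_alternating_unique => // x; rewrite bu' bw.
  have uT : support u \subset transitive_closure T by rewrite (eq_support uu').
  split=> // e eT; have [v [vT bv cv]] := natflow_pushdown iT uT.
  apply/cv => //; rewrite -(independent_natflow iT _ vT (w := w)) ?wT //.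
    by rewrite -wT inE in eT.
  by move=> x; rewrite bv bw.
have [w [wT bw cw]] := natflow_pushdown iT uT.
exists w => //; apply/eqP; rewrite eqEsubset wT; apply/subsetP => e eT.
by rewrite inE; apply/cw => //; apply: cT.
Qed.

(** * Spines and pseudo-components *)

Lemma path_zip (T : eqType) (e : rel T) x s :
  path e x s = all (fun p => e p.1 p.2) (zip (x :: s) s).
Proof. by elim: s x => [|a s IH] x //=; rewrite IH. Qed.

Lemma mem_zip_path (T : eqType) x s (a b : T) :
  (a, b) \in zip (x :: s) s <->
  exists s1 s2, x :: s = s1 ++ [:: a, b & s2].
Proof.
elim: s x => [|y s IH] x /=.
  split=> // -[s1 [s2]]; by case: s1 => [|c [|d s1]].
rewrite inE; split.
  case/orP=> [/eqP[-> ->]|/IH[s1 [s2 h]]]; first by exists [::], s.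
  by exists (x :: s1), s2; rewrite h.
case=> [[|c s1] [s2]] /= [-> h]; first by case: h => -> _; rewrite eqxx.
by apply/orP; right; apply/IH; exists s1, s2.
Qed.

Lemma adj_path_edges n (i : 'I_n.+1) s x y : adj (path_edges i s) x y ->
  ((x, y) \in zip (i :: s) s) || ((y, x) \in zip (i :: s) s).
Proof. by case/adjP=> e; rewrite inE => h [[<- <-]|[<- <-]] //; rewrite orbC. Qed.

Lemma zip_adj n (G : graph n) (i : 'I_n.+1) s x y : path (adj G) i s ->
  (x, y) \in zip (i :: s) s -> adj (path_edges i s) x y.
Proof.
rewrite path_zip => /allP h xy; have /adjP[e _ he] := h _ xy.
apply/adjP; exists e => //; rewrite inE.
by case: he => [[-> ->]|[-> ->]]; rewrite /= xy // orbT.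
Qed.

Lemma path_edges_sub n (G : graph n) (i : 'I_n.+1) s : path (adj G) i s ->
  path_edges i s \subset G.
Proof.
rewrite path_zip => /allP h; apply/subsetP => e; rewrite inE.
case/orP=> /h /adjP[f fG] /= [[h1 h2]|[h1 h2]].
- by rewrite -(edge_inj h1 h2).
- by have := edge_lt e; have := edge_lt f; rewrite h1 h2; lia.
- by have := edge_lt e; have := edge_lt f; rewrite h1 h2; lia.
- by rewrite -(edge_inj h1 h2).
Qed.

Lemma path_edges_path n (G : graph n) (i : 'I_n.+1) s : path (adj G) i s ->
  path (adj (path_edges i s)) i s.
Proof.
move=> p; rewrite path_zip; apply/allP => -[x y] xy /=.
exact: zip_adj p xy.
Qed.

Lemma path_edges_arc n (G : graph n) (i : 'I_n.+1) s : path (arc G) i s ->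
  path (arc (path_edges i s)) i s.
Proof.
rewrite !path_zip => /allP h; apply/allP => -[x y] xy /=.
have /arcP[e _ [h1 h2]] := h _ xy.
by apply/arcP; exists e => //; rewrite inE h1 h2 xy.
Qed.

Lemma path_edges_vertices n (i : 'I_n.+1) s x :
  x \in vertices (path_edges i s) -> x \in i :: s.
Proof.
rewrite inE => /existsP[y] /adj_path_edges /orP[] /mem_zip_path[s1 [s2 ->]];
  by rewrite mem_cat !inE eqxx ?orbT.
Qed.

Lemma vertices_path_edges n (G : graph n) (i : 'I_n.+1) s x :
  path (adj G) i s -> s != [::] -> x \in i :: s ->
  x \in vertices (path_edges i s).
Proof.
move=> p s0 xs; suff [y h] : exists y,
    ((x, y) \in zip (i :: s) s) || ((y, x) \in zip (i :: s) s).
  rewrite inE; apply/existsP; exists y; case/orP: h => h.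
    exact: zip_adj p h.
  by rewrite adj_sym; apply: zip_adj p h.
case: s {p} s0 xs => // a s _; rewrite inE => /orP[/eqP ->|].
  by exists a; rewrite /= inE eqxx.
case/splitPr=> s1 s2; exists (last i s1).
apply/orP; right; apply/mem_zip_path.
by case/lastP: s1 => [|s1 z]; [exists [::], s2|exists (i :: s1), s2; rewrite last_rcons /= cat_rcons].
Qed.

Lemma first_neighbour n (i : 'I_n.+1) s x y : uniq (i :: s) ->
  adj (path_edges i s) i x -> adj (path_edges i s) i y -> x = y.
Proof.
have first z : uniq (i :: s) -> adj (path_edges i s) i z -> z = head i s.
  move=> us /adj_path_edges /orP[] /mem_zip_path[[|a s1] [s2]] /=.
  - by case=> ->.
  - by case=> _ hs; move: us; rewrite /= hs mem_cat inE eqxx orbT.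
  - by case=> _ hs; move: us; rewrite /= hs inE eqxx.
  - by case=> _ hs; move: us; rewrite /= hs mem_cat !inE eqxx !orbT.
by move=> us /(first _ us) -> /(first _ us) ->.
Qed.

Lemma last_neighbour n (i : 'I_n.+1) s x y : uniq (i :: s) ->
  adj (path_edges i s) (last i s) x -> adj (path_edges i s) (last i s) y ->
  x = y.
Proof.
have lastn z : uniq (i :: s) -> adj (path_edges i s) (last i s) z ->
    exists s1, i :: s = s1 ++ [:: z; last i s].
  have tail t1 a t2 : i :: s = t1 ++ a :: t2 -> last i s = last a t2.
    by move=> h; rewrite -[LHS]/(last i (i :: s)) h last_cat.
  move=> us /adj_path_edges /orP[] /mem_zip_path[s1 [s2 h]]; move: us; rewrite h.
    rewrite cat_uniq => /and3P[_ _ /=]; rewrite {1}(tail _ _ _ h) /=.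
    by rewrite mem_last.
  case: s2 h => [|b s2] h; first by exists s1.
  rewrite cat_uniq => /and3P[_ _ /= /and3P[_]].
  rewrite -cat_rcons in h.
  by rewrite {1}(tail _ _ _ h) /= mem_last.
move=> us /(lastn _ us)[s1 h1] /(lastn _ us)[s2 h2].
have := congr1 rev (etrans (esym h1) h2).
by rewrite !rev_cat /= => -[].
Qed.

Lemma inner_neighbours n (G : graph n) (i : 'I_n.+1) s v : path (adj G) i s ->
  uniq (i :: s) -> v \in i :: s -> v != i -> v != last i s ->
  exists x y, [/\ adj (path_edges i s) v x, adj (path_edges i s) v y & x != y].
Proof.
move=> p us vs vi vl; move: vs; rewrite inE (negPf vi) /= => vs.
move: us p vl; case/splitPr: vs => s1 [|y s2]; first by rewrite last_cat eqxx.
move=> us p _; exists (last i s1), y.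
have h1 : (last i s1, v) \in zip (i :: (s1 ++ v :: y :: s2)) (s1 ++ v :: y :: s2).
  apply/mem_zip_path; case/lastP: s1 {us p} => [|s1 z]; first by exists [::], (y :: s2).
  by exists (i :: s1), (y :: s2); rewrite last_rcons /= cat_rcons.
have h2 : (v, y) \in zip (i :: (s1 ++ v :: y :: s2)) (s1 ++ v :: y :: s2).
  by apply/mem_zip_path; exists (i :: s1), s2.
split; first by rewrite adj_sym; apply: zip_adj p h1.
  exact: zip_adj p h2.
have : last i s1 \notin v :: y :: s2.
  move: us; rewrite -cat_cons cat_uniq => /and3P[_ /hasPn h _].
  by apply/negP => /h; rewrite mem_last.
by rewrite !inE !negb_or => /and3P[].
Qed.

(** The ends of a simple path are its vertices with a single neighbour, so the edge set determines
    them as a pair and the order of the vertices tells them apart. This is needed because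
    pseudo-components are edge sets. *)
Lemma path_ends n (G : graph n) (i i' : 'I_n.+1) s s' :
  path (adj G) i s -> uniq (i :: s) -> path (adj G) i' s' -> uniq (i' :: s') ->
  path_edges i s = path_edges i' s' ->
  (i < last i s)%N -> (i' < last i' s')%N -> i = i' /\ last i s = last i' s'.
Proof.
move=> p u p' u' Q lt lt'.
have s0 : s != [::] by apply: contraTneq lt => ->; rewrite ltnn.
have vert v : v \in i :: s -> v \in i' :: s'.
  move=> /(vertices_path_edges p s0); rewrite Q; exact: path_edges_vertices.
have hi : (i == i') || (i == last i' s').
  apply/negPn; rewrite negb_or; apply/negP => /andP[h1 h2].
  have [x [y]] := inner_neighbours p' u' (vert _ (mem_head _ _)) h1 h2.
  by rewrite -Q => -[hx hy /eqP]; apply; apply: first_neighbour hx hy.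
have hj : (last i s == i') || (last i s == last i' s').
  apply/negPn; rewrite negb_or; apply/negP => /andP[h1 h2].
  have [x [y]] := inner_neighbours p' u' (vert _ (mem_last _ _)) h1 h2.
  by rewrite -Q => -[hx hy /eqP]; apply; apply: last_neighbour hx hy.
case/orP: hi => /eqP hi; case/orP: hj => /eqP hj => //; exfalso.
- by rewrite hj hi ltnn in lt.
- by rewrite hj hi in lt; have := ltn_trans lt lt'; rewrite ltnn.
- by rewrite hj hi ltnn in lt.
Qed.

(** A step out of the open interval would cross the arc from [q] to [r], and its two ends are
    avoided. *)
Lemma noncrossing_trapped n (T : graph n) (q r x : 'I_n.+1) s : noncrossing T ->
  arc T q r -> path (adj T) x s -> (q < x < r)%N -> q \notin s -> r \notin s ->
  (q < last x s < r)%N.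
Proof.
move=> nT qr; elim: s x => [|y s IH] x //= /andP[xy ps] /andP[qx xr].
rewrite !inE !negb_or => /andP[qy qs] /andP[ry rs].
apply: IH => //; move: qy ry; rewrite -!val_eqE /= => qy ry.
case/orP: xy => xy.
  have := arc_lt xy; have [yr|ry'] := ltnP y r; first by lia.
  by case: (nT q x r y) => //; lia.
have := arc_lt xy; have [yr|ry'] := ltnP q y; first by lia.
by case: (nT y q x r) => //; lia.
Qed.

(** A later vertex [x] smaller than the second vertex [a] would be trapped under the arc from [i] to
    [a], and the path could not reach its last vertex, which is at least [a]. *)
Lemma noncrossing_path_monotone n (T : graph n) (i : 'I_n.+1) s :
  noncrossing T -> path (adj T) i s -> uniq (i :: s) ->
  {in s, forall x : 'I_n.+1, (i < x)%N} ->
  {in s, forall x : 'I_n.+1, (x <= last i s)%N} -> path (arc T) i s.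
Proof.
move=> nT; elim: s i => [|a s IH] i //= /andP[ia ps] /and3P[ias as_ us] lo hi.
have lt_ia : (i < a)%N by apply: lo; rewrite mem_head.
have {}ia : arc T i a.
  by case/orP: ia => // /arc_lt h; have := ltn_trans h lt_ia; rewrite ltnn.
rewrite ia; apply: IH => //=; first by rewrite as_.
  move=> x xs; rewrite ltnNge leq_eqVlt; apply/negP => /orP[/eqP/val_inj xa|xa].
    by rewrite -xa xs in as_.
  have ix : (i < x)%N by apply: lo; rewrite inE xs orbT.
  have al : (a <= last a s)%N by apply: hi; rewrite mem_head.
  move: ps ias as_ al {us lo hi}; case/splitPr: xs => s1 s2.
  rewrite cat_path /= => /and3P[_ _ p2].
  rewrite !inE !mem_cat !inE !negb_or last_cat /=.
  move=> /and4P[_ _ _ is2] /and3P[_ _ as2] al.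
  have := noncrossing_trapped nT ia p2 _ is2 as2; rewrite ix xa => /(_ isT).
  by lia.
by move=> x xs; apply: hi; rewrite inE xs orbT.
Qed.

Lemma path_connect_ends (T : finType) (e : rel T) x s a b : path e x s ->
  (a, b) \in zip (x :: s) s -> connect e x a /\ connect e b (last x s).
Proof.
move=> p /mem_zip_path[[|c s1] [s2 [xc h]]]; move: p.
  by rewrite h -xc /= => /andP[_ p]; split=> //; apply/connectP; exists s2.
rewrite h -cat_rcons cat_path last_cat last_rcons /= => /andP[p1 p2]; split.
  by apply/connectP; exists (rcons s1 a); rewrite ?last_rcons; case/andP: p2.
by apply/connectP; exists s2; case/andP: p2.
Qed.

Lemma adj_path_vertices n (G : graph n) (i : 'I_n.+1) s :
  path (adj G) i s -> s != [::] -> {subset i :: s <= vertices G}.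
Proof.
move=> p s0 x /(vertices_path_edges p s0); apply: subsetP.
by apply: vertices_sub; apply: path_edges_sub.
Qed.

Lemma smallest_uniq n (G : graph n) v w :
  smallest_vertex G v -> smallest_vertex G w -> v = w.
Proof.
move=> [v1 v2] [w1 w2]; apply/val_inj/eqP; rewrite eqn_leq /=.
by rewrite v2 // w2.
Qed.

Lemma largest_uniq n (G : graph n) v w :
  largest_vertex G v -> largest_vertex G w -> v = w.
Proof.
move=> [v1 v2] [w1 w2]; apply/val_inj/eqP; rewrite eqn_leq /=.
by rewrite v2 // w2.
Qed.

Lemma smallest_lt_largest n (G : graph n) i j :
  smallest_vertex G i -> largest_vertex G j -> (i < j)%N.
Proof.
move=> [iG imin] [_ jmax]; case/verticesP: iG => e eG _.
apply: leq_ltn_trans (imin _ (src_vertices eG)) _.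
exact: leq_trans (edge_lt e) (jmax _ (tgt_vertices eG)).
Qed.

Lemma spine_monotone n (B P : graph n) i j : noncrossing B ->
  smallest_vertex B i -> largest_vertex B j -> is_path B i j P ->
  exists s, [/\ path (arc B) i s, last i s = j, uniq (i :: s)
              & P = path_edges i s].
Proof.
move=> nB hi hj [s [p l u hP]]; exists s; split=> //.
have s0 : s != [::].
  have := smallest_lt_largest hi hj; rewrite -l.
  by case: (s) => //=; rewrite ltnn.
have sv := adj_path_vertices p s0.
apply: noncrossing_path_monotone => // x xs.
  rewrite ltn_neqAle (hi.2 x) ?sv ?inE ?xs ?orbT // andbT.
  by apply: contraTneq xs => /val_inj <-; case/andP: u.
by rewrite l hj.2 // sv // inE xs orbT.
Qed.

Lemma spine_edge_connect n (B P : graph n) i j e : noncrossing B ->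
  smallest_vertex B i -> largest_vertex B j -> is_path B i j P -> e \in P ->
  connect (arc B) i (src e) /\ connect (arc B) (tgt e) j.
Proof.
move=> nB hi hj /(spine_monotone nB hi hj)[s [p l u ->]].
rewrite inE => /orP[]; last first.
  move: p; rewrite path_zip => /allP h /h /= /arc_lt.
  by have := edge_lt e; lia.
by rewrite -l; apply: path_connect_ends.
Qed.

Lemma spine_connect n (B P : graph n) i j : noncrossing B ->
  smallest_vertex B i -> largest_vertex B j -> is_path B i j P ->
  connect (arc P) i j.
Proof.
move=> nB hi hj /(spine_monotone nB hi hj)[s [p l u ->]].
by apply/connectP; exists s => //; apply: path_edges_arc p.
Qed.

Lemma spine_sub n (B P : graph n) : spine B P -> P \subset B.
Proof. by case=> i [j [_ _ [s [p _ _ ->]]]]; apply: path_edges_sub. Qed.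

Lemma spine_vertices_connect n (B P : graph n) x y : spine B P ->
  x \in vertices P -> y \in vertices P -> connect (adj P) x y.
Proof.
case=> i [j [_ _ [s [p _ _ ->]]]] /path_edges_vertices xs
  /path_edges_vertices ys.
have c z : z \in i :: s -> connect (adj (path_edges i s)) i z.
  by move=> zs; apply: (path_connect (path_edges_path p)).
by apply: connect_trans (c _ ys); rewrite connect_adj_sym c.
Qed.

Lemma spine_endpoints n (B P : graph n) i j :
  smallest_vertex B i -> largest_vertex B j -> is_path B i j P ->
  i \in vertices P /\ j \in vertices P.
Proof.
move=> hi hj [s [p l u ->]].
have s0 : s != [::].
  have := smallest_lt_largest hi hj; rewrite -l.
  by case: (s) => //=; rewrite ltnn.
split; apply: vertices_path_edges p s0 _; first exact: mem_head.
by rewrite -l mem_last.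
Qed.

Lemma sorted_gap n (i : 'I_n.+1) s (q r p : 'I_n.+1) :
  sorted (fun x y : 'I_n.+1 => (x < y)%N) (i :: s) ->
  (q, r) \in zip (i :: s) s -> p \in i :: s -> (p <= q)%N || (r <= p)%N.
Proof.
have tr : transitive (fun x y : 'I_n.+1 => (x < y)%N).
  by move=> x y z; apply: ltn_trans.
elim: s i => [|a s IH] i //= /andP[ia ps]; have pa : {in s, forall y : 'I_n.+1, (a < y)%N}.
  exact/allP/(order_path_min tr ps).
rewrite inE => /orP[/eqP[-> ->]|qr].
  rewrite inE => /orP[/eqP ->|]; first by rewrite leqnn.
  rewrite inE => /orP[/eqP ->|/pa h]; first by rewrite leqnn orbT.
  by rewrite (ltnW h) orbT.
rewrite inE => /orP[/eqP ->|pas]; last exact: (IH a).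
apply/orP; left; apply: ltnW; apply: leq_trans ia _.
have : q \in a :: s.
  by case/mem_zip_path: qr => s1 [s2 ->]; rewrite mem_cat !inE eqxx orbT.
by rewrite inE => /orP[/eqP ->|/pa/ltnW].
Qed.

Lemma spine_gap n (B P : graph n) x : noncrossing B -> spine B P ->
  x \in vertices B -> x \notin vertices P ->
  exists q r, [/\ arc P q r, (q < x < r)%N &
    {in vertices P, forall v : 'I_n.+1, (v <= q)%N || (r <= v)%N}].
Proof.
move=> nB [i [j [hi hj hP]]] xB xP.
have [iP jP] := spine_endpoints hi hj hP.
have xj : (x < j)%N.
  rewrite ltn_neqAle (hj.2 _ xB) andbT.
  by apply: contraNneq xP => /val_inj ->.
have [q [r [qr /andP[qx xr] _ _]]] := connect_straddle
  (spine_connect nB hi hj hP) (hi.2 _ xB) xj.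
exists q, r; split=> //.
  rewrite xr andbT ltn_neqAle qx andbT; apply: contraNneq xP => /val_inj <-.
  by case/arcP: qr => e eP [<- _]; apply: src_vertices.
have [s [p l u defP]] := spine_monotone nB hi hj hP.
move=> v; rewrite defP => /path_edges_vertices vs.
apply: (sorted_gap _ _ vs); first by apply: sub_path p => a b /arc_lt.
case/arcP: qr => e; rewrite defP inE => eP [<- <-].
case/orP: eP => // h.
by move: p; rewrite path_zip => /allP/(_ _ h) /= /arc_lt; have := edge_lt e; lia.
Qed.

(** * Subtrees cut out by pseudo-components *)

(* The subtrees met in the recursion defining ps(T): such a subtree is attached
   to the rest of T only at its largest or only at its smallest vertex. *)
Definition full_subtree n (T C : graph n) : Prop :=
  [/\ C \subset T, is_tree_on (vertices C) C, C != set0 &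
      (forall x e, x \in vertices C -> ~ largest_vertex C x ->
         e \in T -> src e = x \/ tgt e = x -> e \in C) \/
      (forall x e, x \in vertices C -> ~ smallest_vertex C x ->
         e \in T -> src e = x \/ tgt e = x -> e \in C)].

Lemma is_forest_sub n (G H : graph n) :
  G \subset H -> is_forest H -> is_forest G.
Proof.
move=> GH fH c /andP[cc uc]; apply: fH; rewrite /ucycle uc andbT.
by apply: sub_cycle cc; apply: adj_sub.
Qed.

Lemma smallest_exists n (G : graph n) : G != set0 ->
  exists i, smallest_vertex G i.
Proof.
case/set0Pn=> e eG; case: (arg_minnP (@nat_of_ord n.+1) (src_vertices eG)).
by move=> i iG imin; exists i; split=> // w /imin.
Qed.

Lemma largest_exists n (G : graph n) : G != set0 ->
  exists i, largest_vertex G i.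
Proof.
case/set0Pn=> e eG; case: (arg_maxnP (@nat_of_ord n.+1) (src_vertices eG)).
by move=> i iG imin; exists i; split=> // w /imin.
Qed.

Lemma spine_exists n (C : graph n) : is_tree_on (vertices C) C -> C != set0 ->
  exists P, spine C P.
Proof.
move=> [_ _ cC] C0; have [i hi] := smallest_exists C0.
have [j hj] := largest_exists C0.
have /connectP[s ps ls] := cC _ _ hi.1 hj.1.
case: (shortenP ps) ls => t pt ut _ lt.
by exists (path_edges i t), i, j; split=> //; exists t.
Qed.

Section Attached.

Variables (n : nat) (B P : graph n) (D : {set graph n}).
Hypotheses (nB : noncrossing B) (fB : is_forest B) (sP : spine B P).
Hypothesis (hD : pseudo_decomposition B P D).

Let iB : independent int B := forest_independent fB.

Let PB : P \subset B := spine_sub sP.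

Let attached_sub (C : graph n) : C \in D -> C \subset B :\: P.
Proof.
move=> CD; rewrite -(cover_partition hD.1.1).
by apply: bigcup_sup CD.
Qed.

Let attached_disjoint (C : graph n) (x : 'I_n.+1) y : C \subset B :\: P ->
  x \in vertices P -> y \in vertices P -> connect (adj C) x y -> x = y.
Proof.
rewrite subsetD => /andP[CB CP] xP yP cxy.
apply: (connect_disjoint iB CB PB CP cxy).
exact: spine_vertices_connect sP xP yP.
Qed.

(** [C'] cannot meet the spine without closing a cycle, so it stays trapped in the gap between
    consecutive spine vertices around [x]. The vertex [v] lies outside this gap, on the side where
    it is extreme in [C], and so remains extreme in the union. *)
Let merge_extreme (C C' : graph n) (x v : 'I_n.+1) :
  C \subset B :\: P -> C' \subset B :\: P -> [disjoint C & C'] ->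
  is_tree_on (vertices C) C -> is_tree_on (vertices C') C' ->
  x \in vertices C -> x \in vertices C' -> x \notin vertices P ->
  v \in vertices P -> v \in vertices C ->
  smallest_vertex C v \/ largest_vertex C v ->
  smallest_vertex (C :|: C') v \/ largest_vertex (C :|: C') v.
Proof.
move=> CBP C'BP dCC' [_ _ cC] [_ _ cC'] xC xC' xP vP vC ext.
have UBP : C :|: C' \subset B :\: P by rewrite subUset CBP.
have xB : x \in vertices B.
  by apply: subsetP xC; apply: vertices_sub; apply: subset_trans CBP (subsetDl _ _).
have noP w : w \in vertices C' -> w \notin vertices P.
  move=> wC'; apply/negP => wP.
  have vw : v = w.
    apply: (attached_disjoint UBP vP wP).
    apply: (@connect_trans _ _ x).
      by apply: connect_subrel (cC _ _ vC xC); apply: adj_sub; apply: subsetUl.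
    by apply: connect_subrel (cC' _ _ xC' wC'); apply: adj_sub; apply: subsetUr.
  have vx : v = x.
    move: CBP C'BP; rewrite !subsetD => /andP[CB _] /andP[C'B _].
    apply: (connect_disjoint iB CB C'B dCC'); first exact: cC.
    by apply: cC' => //; rewrite vw.
  by rewrite -vx vP in xP.
have [q [r [qr xqr gap]]] := spine_gap nB sP xB xP.
have qrP : (q \in vertices P) && (r \in vertices P).
  by case/arcP: (qr) => e eP [<- <-]; rewrite src_vertices // tgt_vertices.
have trapped w : w \in vertices C' -> (q < w < r)%N.
  move=> wC'; have /connectP[s ps ->] := cC' _ _ xC' wC'.
  have C'B : C' \subset B by apply: subset_trans C'BP (subsetDl _ _).
  have sC' y : y \in s -> y \in vertices C'.
    by move=> ys; case: (s) ps ys => // a t p yt; apply: (adj_path_vertices p); rewrite // inE yt orbT.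
  apply: (noncrossing_trapped nB (arc_sub PB qr) _ xqr).
  - exact: sub_path (adj_sub C'B) _ _ ps.
  - by apply/negP => /sC' /noP; case/andP: qrP => ->.
  - by apply/negP => /sC' /noP; case/andP: qrP => _ ->.
have vert w : w \in vertices (C :|: C') ->
    (w \in vertices C) || (w \in vertices C').
  case/verticesP=> e /setUP[] eC h; apply/orP; [left|right];
  by apply/verticesP; exists e.
have vU : v \in vertices (C :|: C').
  by apply: subsetP vC; apply: vertices_sub; apply: subsetUl.
case: ext => -[_ ext]; [left|right]; split=> // w /vert /orP[/ext //|/trapped].
  by move: (gap v vP) (ext x xC) xqr; clear; lia.
by move: (gap v vP) (ext x xC) xqr; clear; lia.
Qed.

(* Otherwise the tree containing the edge e could be merged with C. *)
Lemma attached_closed (C : graph n) x e : C \in D -> x \in vertices C ->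
  x \notin vertices P -> e \in B -> src e = x \/ tgt e = x -> e \in C.
Proof.
move=> CD xC xP eB ex; apply/negPn/negP => eC.
have eP : e \notin P.
  apply/negP => eP; case/negP: xP; apply/verticesP; by exists e.
have [[partD attD] minD] := hD.
have eD : e \in cover D by rewrite (cover_partition partD) inE eP.
pose C' := pblock D e.
have C'D : C' \in D by apply: pblock_mem.
have eC' : e \in C' by rewrite mem_pblock.
have CC' : C' != C by apply: contraNneq eC => <-.
have xC' : x \in vertices C' by apply/verticesP; exists e.
have trD : trivIset D by case/and3P: partD.
have dCC' : [disjoint C & C'].
  by move/trivIsetP: trD; apply=> //; rewrite eq_sym.
have [[tC extC] [tC' extC']] := (attD _ CD, attD _ C'D).
pose D1 := D :\ C :\ C'.
have C'D1 : C' \in D :\ C by rewrite !inE CC'.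
have partD1 : partition D1 (B :\: P :\: C :\: C').
  by apply: partitionD1 => //; apply: partitionD1.
have C0 : C != set0.
  by apply: contraTneq CD => ->; rewrite (partition0 partD).
have U0 : C :|: C' != set0.
  by apply: contraNneq C0 => /eqP; rewrite setU_eq0 => /andP[].
have dU : [disjoint C :|: C' & B :\: P :\: C :\: C'].
  rewrite -setI_eq0; apply/eqP/setP => f; rewrite !inE.
  by case: (f \in C); case: (f \in C'); rewrite ?andbF.
have [CBP C'BP] := (attached_sub CD, attached_sub C'D).
apply: minD; exists ((C :|: C') |: D1); split; last first.
  have UD1 : C :|: C' \notin D1.
    apply/negP => UD1; case/set0Pn: U0 => f fU.
    have : f \in cover D1 by apply/bigcupP; exists (C :|: C').
    by rewrite (cover_partition partD1) (disjointFr dU fU).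
  by rewrite cardsU1 UD1 (cardsD1 C D) CD (cardsD1 C' (D :\ C)) C'D1.
split.
  have -> : B :\: P = (C :|: C') :|: (B :\: P :\: C :\: C').
    apply/setP => f; rewrite !inE.
    have := subsetP CBP f; have := subsetP C'BP f; rewrite !inE.
    case: (f \in C); case: (f \in C') => //=; rewrite ?andbT ?andbF //.
    - by move=> _ /(_ isT) ->.
    - by move=> _ /(_ isT) ->.
    - by move=> /(_ isT) ->.
  exact: partitionU1.
move=> K /setU1P[->|]; last by rewrite !inE => /and3P[_ _ /attD].
split; first split=> //.
- apply: is_forest_sub fB; rewrite subUset.
  by rewrite !(subset_trans _ (subsetDl B P)).
- have cx y : y \in vertices (C :|: C') -> connect (adj (C :|: C')) x y.
    case: tC tC' => [_ _ cC] [_ _ cC'].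
    case/verticesP=> f /setUP[] fC hf.
      apply: connect_subrel (cC _ _ xC _); first exact: adj_sub (subsetUl _ _).
      by apply/verticesP; exists f.
    apply: connect_subrel (cC' _ _ xC' _); first exact: adj_sub (subsetUr _ _).
    by apply/verticesP; exists f.
  move=> y z /cx xy /cx xz; apply: connect_trans xz.
  by rewrite connect_adj_sym.
- move=> v vP; rewrite inE => /existsP[y /adjP[f]].
  case/setUP=> fC hf.
    have vC : v \in vertices C.
      by apply/verticesP; exists f => //; case: hf => -[]; [left|right].
    by apply: (@merge_extreme C C' x v) => //; apply: extC.
  have vC : v \in vertices C'.
    by apply/verticesP; exists f => //; case: hf => -[]; [left|right].
  rewrite setUC; apply: (@merge_extreme C' C x v) => //; last exact: extC'.
  by rewrite disjoint_sym.
Qed.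

(** Two common vertices of [C] and the spine would give a cycle, so there is at most one, and it is
    extreme in [C]. Any other vertex of [C] keeps its edges of [B] by [attached_closed]; being off
    the spine it is not extreme in [B], so these are all its edges of [T]. The drop in cardinality
    drives the recursion. *)
Lemma attached_full (T C : graph n) : full_subtree T B -> C \in D ->
  full_subtree T C /\ (#|C| < #|B|)%N.
Proof.
move=> [BT tB B0 fullB] CD; have CBP := attached_sub CD.
have CB : C \subset B := subset_trans CBP (subsetDl _ _).
have [[partD attD] _] := hD; have [tC extC] := attD _ CD.
have C0 : C != set0.
  by apply: contraTneq CD => ->; rewrite (partition0 partD).
have [i [j [hi hj hP]]] := sP.
have [iP jP] := spine_endpoints hi hj hP.
have closed x e : x \in vertices C -> x \notin vertices P -> e \in T ->
    src e = x \/ tgt e = x -> e \in C.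
  move=> xC xP eT ex; apply: (attached_closed CD xC xP _ ex).
  have xB : x \in vertices B by apply: subsetP xC; apply: vertices_sub.
  case: fullB => fullB; apply: (fullB x e xB _ eT ex) => hx.
    by rewrite (largest_uniq hx hj) jP in xP.
  by rewrite (smallest_uniq hx hi) iP in xP.
split; last first.
  have /set0Pn[f fP] : P != set0.
    case/verticesP: iP => f fP _; apply/set0Pn; by exists f.
  apply: proper_card; apply/properP; split=> //; exists f.
    exact: subsetP PB _ fP.
  by apply/negP => /(subsetP CBP); rewrite inE fP.
split=> //; first exact: subset_trans BT.
have [[p /andP[pC pP]]|noP] := pselect (exists p, (p \in vertices C) && (p \in vertices P)); last first.
  left=> x e xC _ eT ex; apply: (closed x) => //.
  by apply/negP => xP; apply: noP; exists x; rewrite xC.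
have onlyp x : x \in vertices C -> x != p -> x \notin vertices P.
  move=> xC xp; apply/negP => xP; case/eqP: xp.
  by apply: (attached_disjoint CBP) => //; case: tC => _ _; apply.
case: (extC p pP pC) => hp; [right|left] => x e xC hx eT ex;
  apply: (closed x) => //; apply: onlyp => //; apply/eqP => xp;
  by apply: hx; rewrite xp.
Qed.

End Attached.

(** Single edges form an admissible partition, both ends of an edge being extreme; an admissible
    partition with the fewest blocks is then minimal. *)
Lemma decomposition_exists n (B P : graph n) : is_forest B ->
  exists D, pseudo_decomposition B P D.
Proof.
move=> fB; pose D0 : {set graph n} := [set [set e] | e in B :\: P].
have att0 : attached_trees B P D0.
  split.
    apply/and3P; split.
    - by apply/eqP; rewrite cover_imset; apply/setP => e; apply/bigcupP/idP =>
        [[f fB' /set1P ->]|eB'] //; exists e; rewrite ?set11.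
    - apply/trivIsetP => _ _ /imsetP[e _ ->] /imsetP[f _ ->] ef.
      by rewrite disjoints1 inE; apply: contraNneq ef => ->.
    - by apply/negP => /imsetP[e _ /setP/(_ e)]; rewrite !inE eqxx.
  move=> _ /imsetP[e eB ->].
  have vert v : v \in vertices [set e] -> v = src e \/ v = tgt e.
    by case/verticesP=> f /set1P -> [<-|<-]; [left|right].
  have se : src e \in vertices [set e] by apply: src_vertices; rewrite inE.
  have te : tgt e \in vertices [set e] by apply: tgt_vertices; rewrite inE.
  have le := ltnW (edge_lt e).
  split; first split=> //.
  - apply: is_forest_sub fB; rewrite sub1set; by case/setDP: eB.
  - have c : connect (adj [set e]) (src e) (tgt e).
      by apply: connect1; apply/adjP; exists e; rewrite ?inE //; left.
    by move=> x y /vert[] -> /vert[] -> //; rewrite connect_adj_sym.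
  - move=> v _ /vert[] ->; [left|right]; split=> // w /vert[] -> //.
pose good D := `[< attached_trees B P D >].
have good0 : good D0 by apply/asboolP.
case: (arg_minnP (fun D : {set graph n} => #|D|) good0) => D /asboolP attD minD.
exists D; split=> // -[D' [attD' cD']].
have := minD D' (introT (asboolP _) attD').
by rewrite -cD' ltnn.
Qed.

Lemma full_subtree_refl n (T : graph n) : is_tree_on (vertices T) T ->
  T != set0 -> full_subtree T T.
Proof. by move=> tT T0; split=> //; left. Qed.

Lemma pseudo_component_spineP n (T B Q : graph n) : noncrossing T ->
  pseudo_component B Q -> full_subtree T B ->
  exists2 C, full_subtree T C & spine C Q.
Proof.
move=> nT; elim=> {B Q} [B P sP fB|B P D C Q sP hD CD _ IH fB].
  by exists B.
case: (fB) => BT [_ fBB _] _ _; apply: IH.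
have nB := noncrossing_sub BT nT.
by have [] := attached_full nB fBB sP hD fB CD.
Qed.

Lemma edge_pseudo_component n (T B : graph n) e : noncrossing T ->
  full_subtree T B -> e \in B ->
  exists Q C, [/\ pseudo_component B Q, full_subtree T C, spine C Q & e \in Q].
Proof.
move=> nT; have [m] := ubnP #|B|; elim: m B => // m IH B le_m fB eB.
have [BT tB B0 _] := fB; have [P sP] := spine_exists tB B0.
have [eP|eP] := boolP (e \in P).
  by exists P, B; split=> //; apply: pseudo_component_spine.
have fBB : is_forest B by case: tB.
have [D hD] := decomposition_exists P fBB.
have eD : e \in cover D by rewrite (cover_partition hD.1.1) inE eP.
have CD : pblock D e \in D by apply: pblock_mem.
have [fC lt] := attached_full (noncrossing_sub BT nT) fBB sP hD fB CD.
have [||Q [C [pQ fC' sQ eQ]]] := IH (pblock D e) _ fC.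
- exact: leq_trans lt _.
- by rewrite mem_pblock.
exists Q, C; split=> //.
exact: pseudo_component_attached sP hD CD pQ.
Qed.

(** * Forests counted by f_{T,k} *)

Lemma pseudo_component_on_spine n (T : graph n) i j : noncrossing T ->
  full_subtree T T -> pseudo_component_on T i j ->
  exists C Q, [/\ full_subtree T C, smallest_vertex C i, largest_vertex C j
                & is_path C i j Q].
Proof.
move=> nT fT [ij [Q pQ [s [p l u hQ]]]].
have [C fC [i' [j' [hi' hj' hP]]]] := pseudo_component_spineP nT pQ fT.
have [s' [p' l' u' hQ']] := hP.
have CT : C \subset T by case: fC.
have := path_ends p u (sub_path (adj_sub CT) p') u' (etrans (esym hQ) hQ').
rewrite l l' => /(_ ij (smallest_lt_largest hi' hj')) [hi hj].
by rewrite hi hj; exists C, Q.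
Qed.

Lemma full_subtree_inner n (T C : graph n) i j x e : full_subtree T C ->
  smallest_vertex C i -> largest_vertex C j -> x \in vertices C ->
  x != i -> x != j -> e \in T -> src e = x \/ tgt e = x -> e \in C.
Proof.
move=> [_ _ _ fC] hi hj xC /eqP xi /eqP xj eT ex.
case: fC => fC; apply: (fC x e) => // hx.
  by apply: xj; apply: largest_uniq hx hj.
by apply: xi; apply: smallest_uniq hx hi.
Qed.

Lemma spine_subtree_connect n (T C Q : graph n) i j : noncrossing T ->
  full_subtree T C -> smallest_vertex C i -> largest_vertex C j ->
  is_path C i j Q -> connect (arc C) i j.
Proof.
move=> nT [CT _ _ _] hi hj hQ.
have h := spine_connect (noncrossing_sub CT nT) hi hj hQ.
apply: connect_subrel h; apply: arc_sub; case: hQ => s [p _ _ ->].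
exact: path_edges_sub p.
Qed.

(** Arcs can leave [C] only from [j], its largest vertex, so a path that gets as far as [j] goes
    through it. *)
Lemma connect_leave n (T C : graph n) (j x b : 'I_n.+1) : largest_vertex C j ->
  (forall x e, x \in vertices C -> x != j -> e \in T -> src e = x -> e \in C) ->
  x \in vertices C -> connect (arc T) x b -> (j <= b)%N -> connect (arc T) j b.
Proof.
move=> hj full xC /connectP[s p l] jb; elim: s x p l xC => [|a s IH] x /=.
  move=> _ bx xC; suff -> : j = b by [].
  by apply/val_inj/eqP; rewrite eqn_leq jb bx hj.2.
case/andP=> xa p l xC; have [<-|xj] := eqVneq x j.
  by apply/connectP; exists (a :: s); rewrite //= xa.
case/arcP: xa => e eT [ex ea]; apply: (IH a p l).
by rewrite -ea tgt_vertices // (full x e).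
Qed.

Lemma connect_enter n (T C : graph n) (i x a : 'I_n.+1) : smallest_vertex C i ->
  (forall x e, x \in vertices C -> x != i -> e \in T -> tgt e = x -> e \in C) ->
  x \in vertices C -> connect (arc T) a x -> (a <= i)%N -> connect (arc T) a i.
Proof.
move=> hi full xC /connectP[s p l] ai; elim/last_ind: s x p l xC => [|s b IH] x /=.
  move=> _ xa xC; suff -> : i = a by [].
  by apply/val_inj/eqP; rewrite eqn_leq ai -xa hi.2.
rewrite rcons_path last_rcons => /andP[p lb] -> bC.
have [<-|bi] := eqVneq b i.
  by apply/connectP; exists (rcons s b); rewrite ?last_rcons // rcons_path p lb.
case/arcP: lb => e eT [el eb]; apply: (IH (last a s) p erefl).
by rewrite -el src_vertices // (full b e).
Qed.

Section Conditions.

Variables (n : nat) (T F : graph n).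
Hypotheses (nT : noncrossing T) (fT : full_subtree T T).
Hypotheses (nF : noncrossing F) (aF : alternating F).
Hypothesis FT : F \subset transitive_closure T.

Let fully_covered := {in T, forall e, exists2 f, f \in F & covers T f e}.

(** Take the edge [f] of [F] out of [i] with the farthest end. If it stops short of [j], the spine
    arc passing over that end is covered by some [f'] reaching farther. A start of [f'] at [i]
    contradicts the choice of [f], a start at [tgt f] contradicts alternation, and a start in
    between makes [f] and [f'] cross. *)
Lemma covered_left i j : fully_covered -> left_pseudo_component_on T i j ->
  exists j1 : 'I_n.+1, (j <= j1)%N /\ arc F i j1.
Proof.
move=> cov [/(pseudo_component_on_spine nT fT)[C [Q [fC hi hj hQ]]] noin].
have CT : C \subset T by case: fC.
have from_i a : connect (arc T) a i -> a = i.
  move=> ai; apply/eqP/negPn/negP => /(connect_arc_last ai)[k _ ki].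
  by apply: noin; exists k.
(* Followed backwards, the path stays in [C], since inner vertices have all their edges there; it
   cannot pass [i], which no arc enters. *)
have back a x : connect (arc T) a x -> x \in vertices C -> (x < j)%N ->
    (i <= a)%N.
  have [m] := ubnP (x : nat); elim: m x => // m IH x le_m ax xC xj.
  have [->|nax] := eqVneq a x; first exact: hi.2.
  have [k ak kx] := connect_arc_last ax nax.
  have kx' := arc_lt kx.
  have xi : x != i by apply: contra_notN noin => /eqP <-; exists k.
  have xj' : x != j by apply: contraTneq xj => ->; rewrite ltnn.
  case/arcP: kx => e eT [ek ex].
  have eC := full_subtree_inner fC hi hj xC xi xj' eT (or_intror ex).
  apply: (IH k) => //; first exact: leq_trans kx' _.
    by rewrite -ek src_vertices.
  exact: ltn_trans xj.
have [f0 f0F f0i] : exists2 f, f \in F & src f = i.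
  case/verticesP: (hi.1) => e eC [ei|ei]; last first.
    case: noin; exists (src e); rewrite -ei; apply: arc_edge.
    exact: subsetP CT _ eC.
  have [f fF [fe _]] := cov e (subsetP CT _ eC).
  by exists f => //; apply: from_i; rewrite -ei.
pose inF f := (f \in F) && (src f == i).
have f0in : inF f0 by rewrite /inF f0F f0i eqxx.
case: (arg_maxnP (fun f : edge n => tgt f : nat) f0in) => f /andP[fF /eqP fi] fmax.
have [jf|fj] := leqP j (tgt f).
  by exists (tgt f); split=> //; rewrite -fi; apply: arc_edge.
have iltf : (i <= tgt f)%N by rewrite -fi ltnW // edge_lt.
have [x [y [xy /andP[xf fy] _ _]]] := connect_straddle
  (spine_subtree_connect nT fC hi hj hQ) iltf fj.
case/arcP: xy => g gC [gx gy].
have [f' f'F []] := cov g (subsetP CT _ gC); rewrite gx gy => c1 c2.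
have xC : x \in vertices C by rewrite -gx src_vertices.
have yC : y \in vertices C by rewrite -gy tgt_vertices.
have xj : (x < j)%N by apply: leq_trans (hj.2 _ yC); rewrite -gx -gy edge_lt.
have if' := back _ _ c1 xC xj.
have f'x := connect_arc_le c1; have yf' := connect_arc_le c2.
have [f'i|f'i] := eqVneq (src f') i.
  have := fmax f'; rewrite /inF f'F f'i eqxx => /(_ isT) h.
  have := leq_trans fy (leq_trans yf' h); by rewrite ltnn.
have [f'f|f'f] := eqVneq (src f') (tgt f).
  by case: ((alternating_edges F).1 aF f f' fF f'F).
case: ((noncrossing_edges F).1 nF f f' fF f'F); split.
- by rewrite fi ltn_neqAle if' andbT; apply: contraNneq f'i => /val_inj ->.
- rewrite ltn_neqAle (leq_trans f'x xf) andbT.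
  by apply: contraNneq f'f => /val_inj ->.
- exact: leq_trans fy yf'.
Qed.

(** The mirror image of [covered_left], with the edge of [F] into [j] that starts leftmost. *)
Lemma covered_right i j : fully_covered -> right_pseudo_component_on T i j ->
  exists i1 : 'I_n.+1, (i1 <= i)%N /\ arc F i1 j.
Proof.
move=> cov [/(pseudo_component_on_spine nT fT)[C [Q [fC hi hj hQ]]] noout].
have CT : C \subset T by case: fC.
have from_j a : connect (arc T) j a -> j = a.
  move=> ja; apply/eqP/negPn/negP => /(connect_arc_first ja)[k jk _].
  by apply: noout; exists k.
have forth b x : connect (arc T) x b -> x \in vertices C -> (i < x)%N ->
    (b <= j)%N.
  have [m] := ubnP (n - x)%N; elim: m x => // m IH x le_m xb xC ix.
  have [<-|nxb] := eqVneq x b; first exact: hj.2.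
  have [k xk kb] := connect_arc_first xb nxb.
  have xk' := arc_lt xk.
  have xj : x != j by apply: contra_notN noout => /eqP <-; exists k.
  have xi : x != i by apply: contraTneq ix => ->; rewrite ltnn.
  case/arcP: xk => e eT [ex ek].
  have eC := full_subtree_inner fC hi hj xC xi xj eT (or_introl ex).
  apply: (IH k) => //.
  - have kn : (k <= n)%N by rewrite -ltnS ltn_ord.
    by move: le_m xk' kn; clear; lia.
  - by rewrite -ek tgt_vertices.
  - exact: ltn_trans xk'.
have [f0 f0F f0j] : exists2 f, f \in F & tgt f = j.
  case/verticesP: (hj.1) => e eC [ej|ej].
    case: noout; exists (tgt e); rewrite -ej; apply: arc_edge.
    exact: subsetP CT _ eC.
  have [f fF [_ fe]] := cov e (subsetP CT _ eC).
  by exists f => //; apply/esym/from_j; rewrite -ej.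
pose inF f := (f \in F) && (tgt f == j).
have f0in : inF f0 by rewrite /inF f0F f0j eqxx.
case: (arg_minnP (fun f : edge n => src f : nat) f0in) => f /andP[fF /eqP fj] fmin.
have [fi|if_] := leqP (src f) i.
  by exists (src f); split=> //; rewrite -fj; apply: arc_edge.
have sf0 : (0 < src f)%N := leq_ltn_trans (leq0n _) if_.
(* [connect_straddle] yields [x <= v < y]; the mirrored argument needs [x < src f <= y], hence [v]
   is the predecessor of [src f]. *)
have predP : ((src f).-1 < n.+1)%N by apply: leq_ltn_trans (leq_pred _) _.
have [||x [y [xy /andP[xf fy] _ _]]] := @connect_straddle _ _ _ (Ordinal predP) _
  (spine_subtree_connect nT fC hi hj hQ).
- by rewrite /= -ltnS prednK.
- by rewrite /= prednK // ltnW // -fj edge_lt.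
rewrite /= in xf fy; rewrite prednK // in fy.
have {}xf : (x < src f)%N by rewrite -(prednK sf0) ltnS.
case/arcP: xy => g gC [gx gy].
have [f' f'F []] := cov g (subsetP CT _ gC); rewrite gx gy => c1 c2.
have xC : x \in vertices C by rewrite -gx src_vertices.
have yC : y \in vertices C by rewrite -gy tgt_vertices.
have iy : (i < y)%N by apply: leq_ltn_trans (hi.2 _ xC) _; rewrite -gx -gy edge_lt.
have f'j := forth _ _ c2 yC iy.
have f'x := connect_arc_le c1; have yf' := connect_arc_le c2.
have [f'j'|f'j'] := eqVneq (tgt f') j.
  have := fmin f'; rewrite /inF f'F f'j' eqxx => /(_ isT) h.
  have := leq_ltn_trans (leq_trans h f'x) xf; by rewrite ltnn.
have [f'f|f'f] := eqVneq (tgt f') (src f).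
  by case: ((alternating_edges F).1 aF f' f f'F fF).
case: ((noncrossing_edges F).1 nF f' f f'F fF); split.
- exact: leq_ltn_trans f'x xf.
- rewrite ltn_neqAle (leq_trans fy yf') andbT.
  by apply: contraNneq f'f => /val_inj ->.
- by rewrite fj ltn_neqAle f'j andbT; apply: contraNneq f'j' => /val_inj ->.
Qed.

(** The edge [e] lies on the spine of a subtree [C] attached to the rest of [T] at one extreme only.
    If this is the largest vertex [j], no arc enters [i], so the left condition gives an edge of [F]
    from [i] to some [j1] at or beyond [j]. The path of [T] to [j1] has to leave [C] through [j], so
    the edge covers the whole spine. The other case is symmetric. *)
Lemma conditions_cover :
  (forall i j, right_pseudo_component_on T i j ->
     exists i1 : 'I_n.+1, (i1 <= i)%N /\ arc F i1 j) ->
  (forall i j, left_pseudo_component_on T i j ->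
     exists j1 : 'I_n.+1, (j <= j1)%N /\ arc F i j1) ->
  fully_covered.
Proof.
move=> cr cl e eT; have [Q [C [pQ fC [i [j [hi hj hQ]]] eQ]]] :=
  edge_pseudo_component nT fT eT.
have ij := smallest_lt_largest hi hj.
have CT : C \subset T by case: fC.
have [c1 c2] := spine_edge_connect (noncrossing_sub CT nT) hi hj hQ eQ.
have sub := connect_subrel (arc_sub CT).
have on : pseudo_component_on T i j.
  split=> //; exists Q => //; case: hQ => s [p l u hQ]; exists s; split=> //.
  exact: sub_path (adj_sub CT) _ _ p.
have FTc a b : arc F a b -> connect (arc T) a b.
  by move/(arc_sub FT)/transitive_closureP => [].
have edgeF a b : arc F a b -> connect (arc T) a (src e) ->
    connect (arc T) (tgt e) b -> exists2 f, f \in F & covers T f e.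
  by move=> /arcP[f fF [fa fb]] h1 h2; exists f; rewrite // /covers fa fb.
case: (fC) => _ _ _ [full|full].
  have [|j1 [jj1 ij1]] := cl i j.
    split=> // -[s /arcP[f f_T [fs fi]]].
    have fC' : f \in C.
      apply: (full i f hi.1 _ f_T (or_intror fi)) => hi'.
      by rewrite (largest_uniq hi' hj) ltnn in ij.
    have := hi.2 _ (src_vertices fC'); rewrite -fi.
    by have := edge_lt f; rewrite ltnNge => /negP.
  apply: (edgeF _ _ ij1 (sub _ _ c1)); apply: connect_trans (sub _ _ c2) _.
  apply: (connect_leave hj _ hi.1 (FTc _ _ ij1) jj1) => x f xC xj f_T fx.
  apply: (full x f xC _ f_T (or_introl fx)) => hx.
  by rewrite (largest_uniq hx hj) eqxx in xj.
have [|i1 [i1i i1j]] := cr i j.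
  split=> // -[s /arcP[f f_T [fj fs]]].
  have fC' : f \in C.
    apply: (full j f hj.1 _ f_T (or_introl fj)) => hj'.
    by rewrite (smallest_uniq hj' hi) ltnn in ij.
  have := hj.2 _ (tgt_vertices fC'); rewrite -fj.
  by have := edge_lt f; rewrite ltnNge => /negP.
apply: (edgeF _ _ i1j _ (sub _ _ c2)); apply: connect_trans (sub _ _ c1).
apply: (connect_enter hi _ hj.1 (FTc _ _ i1j) i1i) => x f xC xi f_T fx.
apply: (full x f xC _ f_T (or_intror fx)) => hx.
by rewrite (smallest_uniq hx hi) eqxx in xi.
Qed.

End Conditions.

Lemma tree_extremes n (T : graph n) : (0 < n)%N -> is_tree_on [set: 'I_n.+1] T ->
  [/\ T != set0, smallest_vertex T ord0 & largest_vertex T ord_max].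
Proof.
move=> n0 [_ _ cT].
have nz : ord0 != ord_max :> 'I_n.+1 by rewrite -val_eqE /= eq_sym -lt0n.
have vert v : v \in vertices T.
  have [w vw] : exists w, v != w.
    have [->|h] := eqVneq v ord0; first by exists ord_max.
    by exists ord0.
  have /connectP[s p l] := cT v w (in_setT _) (in_setT _).
  case: s p l => [|a s] /=; first by move=> _ wv; rewrite wv eqxx in vw.
  by move=> /andP[va _] _; rewrite inE; apply/existsP; exists a.
split.
- case/verticesP: (vert ord0) => e eT _; apply/set0Pn; by exists e.
- by split=> // w _; apply: leq0n.
- by split=> // w _; rewrite -ltnS; apply: ltn_ord.
Qed.

(** On a longer cycle let [i] be the smallest vertex and [m] the smaller of its two neighbours. The
    rest of the cycle joins these neighbours and contains an arc from some [a] with [i < a <= m] to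
    a vertex beyond [m]. It violates alternation if [a = m], and crosses the arc from [i] to [m]
    otherwise. *)
Lemma noncrossing_alternating_forest n (F : graph n) :
  noncrossing F -> alternating F -> is_forest F.
Proof.
move=> nF /alternating_edges aF c uc; rewrite leqNgt; apply/negP => c3.
have [x0 x0c] : exists x, x \in c.
  by case: c c3 {uc} => // x c _; exists x; rewrite mem_head.
case: (@arg_minnP _ x0 (fun x => x \in c) (@nat_of_ord n.+1) x0c) => i ic imin.
case: (rot_to ic) => r s cs; move: uc c3.
rewrite -(rot_ucycle r) -(size_rot r) cs.
have {imin cs ic x0 x0c}: {in i :: s, forall x : 'I_n.+1, (i <= x)%N}.
  by move=> x; rewrite -cs mem_rot => /imin.
case: s => [|j [|b s]] // imin /andP[cyc uniq_c] _.
set k := last b s; set t := b :: s.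
have tlast : last j t = k by [].
have {cyc} [ij [pt ki]] : adj F i j /\ path (adj F) j t /\ adj F k i.
  by move: cyc; rewrite /= rcons_path => /and4P[-> -> -> ->].
have gt x : x \in j :: t -> (i < x)%N.
  move=> xt; rewrite ltn_neqAle; apply/andP; split; last first.
    by apply: imin; rewrite in_cons xt orbT.
  by apply: contraTneq xt => /val_inj <-; case/andP: uniq_c.
have up x : x \in j :: t -> adj F i x -> arc F i x.
  by move=> /gt ix /orP[//|/arc_lt xi]; have := ltn_trans ix xi; rewrite ltnn.
have jt : j \in j :: t by rewrite mem_head.
have kt : k \in j :: t by rewrite -tlast mem_last.
have {}ij := up j jt ij; have {ki}ik : arc F i k by apply: up; rewrite // adj_sym.
have jk : j != k.
  apply/eqP => jk; case/and3P: uniq_c => _ jt' _; move: jt'.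
  by rewrite jk mem_last.
have step (m x : 'I_n.+1) u : path (adj F) x u ->
    (x <= m)%N != (last x u <= m)%N ->
    exists a b, [/\ a \in x :: u, arc F a b & (a <= m < b)%N].
  elim: u x => [|y u IH] x /=; first by rewrite eqxx.
  case/andP=> xy pu h; have [e|ne] := eqVneq (x <= m)%N (y <= m)%N.
    rewrite e in h; have [a [b' [au ab mab]]] := IH y pu h.
    by exists a, b'; rewrite inE au orbT.
  case/orP: xy => xy; have lt := arc_lt xy.
    by exists x, y; rewrite mem_head; split=> //; move: ne lt; clear; lia.
  exists y, x; rewrite !inE eqxx orbT; split=> //.
  by move: ne lt; clear; lia.
have [m [im mjk]] : exists m, arc F i m /\ (j <= m)%N != (k <= m)%N.
  have := jk; rewrite -val_eqE /= neq_ltn => /orP[] h.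
    by exists j; rewrite leqnn leqNgt h.
  by exists k; rewrite leqnn leqNgt h.
have [a [b' [at_ ab /andP[am mb]]]] := step m j t pt mjk.
have [e eF [ei em]] := arcP _ _ _ im.
have [f fF [fa fb]] := arcP _ _ _ ab.
have [ea|nea] := eqVneq a m.
  by apply: (aF e f eF fF); rewrite em fa.
apply: (nF i a m b') => //; first exact: gt.
by rewrite ltn_neqAle am andbT.
Qed.

Lemma sum_delta (I : finType) (R : comNzRingType) (c : I -> R) (v : I) :
  \sum_x c x * (v == x)%:R = c v.
Proof.
rewrite (bigD1 v) //= eqxx mulr1 big1 ?addr0 // => x /negPf.
by rewrite eq_sym => ->; rewrite mulr0.
Qed.

(* The incidence matrix of a tree has independent rows and, since the tree is
   connected, a one-dimensional space of linear relations between columns. *)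
Lemma card_tree n (T : graph n) : is_tree_on [set: 'I_n.+1] T -> #|T| = n.
Proof.
move=> [_ fT cT].
pose A : 'M[rat]_(#|T|, n.+1) := \matrix_(k, x) incidence rat (enum_val k) x.
have rA : row_free A.
  apply: inj_row_free => v vA.
  pose z e : rat := \sum_k v 0 k * (e == enum_val k)%:R.
  have zT e : e \notin T -> z e = 0.
    move=> eT; apply: big1 => k _; case: eqP => [h|_]; last by rewrite mulr0.
    by rewrite h enum_valP in eT.
  have z0 : netflow z =1 (fun=> 0).
    move=> x; have /matrixP/(_ 0 x) := vA; rewrite !mxE => h; rewrite -[RHS]h.
    rewrite /netflow; under eq_bigr do rewrite mulr_suml.
    rewrite exchange_big; apply: eq_bigr => k _; rewrite mxE.
    by rewrite -netflow1 /netflow mulr_sumr; apply: eq_bigr => e _; rewrite mulrA.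
  apply/rowP => k; rewrite mxE.
  have := forest_independent fT zT z0 (enum_val k).
  rewrite /z (bigD1 k) //= eqxx mulr1 big1 ?addr0 // => l lk.
  by rewrite (inj_eq enum_val_inj) eq_sym (negPf lk) mulr0.
have rk : (\rank (kermx A^T) = n.+1 - #|T|)%N.
  by rewrite mxrank_ker mxrank_tr; move/eqP: rA => ->.
pose J : 'rV[rat]_n.+1 := const_mx 1.
have J1 : (J <= kermx A^T)%MS.
  apply/sub_kermxP/rowP => k; rewrite !mxE.
  under eq_bigr => x do rewrite !mxE mulrBr.
  by rewrite sumrB !(sum_delta (fun=> 1)) subrr.
have J2 : (kermx A^T <= J)%MS.
  apply/rV_subP => v /sub_kermxP vA.
  have eqv e : e \in T -> v 0 (src e) = v 0 (tgt e).
    move=> eT; have /matrixP/(_ 0 (enum_rank_in eT e)) := vA; rewrite !mxE => h.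
    apply/eqP; rewrite -subr_eq0 -[X in _ == X]h; apply/eqP.
    under [RHS]eq_bigr => x do rewrite !mxE enum_rankK_in // mulrBr.
    by rewrite sumrB !sum_delta.
  have cv x : v 0 x = v 0 ord0.
    have /connectP[s p l] := cT x ord0 (in_setT _) (in_setT _).
    elim: s x p l => [|a s IH] x /=; first by move=> _ ->.
    case/andP=> /adjP[e eT he] p l; rewrite -(IH a p l).
    by case: he => [[<- <-]|[<- <-]]; rewrite (eqv _ eT).
  apply/sub_rVP; exists (v 0 ord0); apply/rowP => x.
  by rewrite !mxE mulr1 cv.
have rJ : \rank (kermx A^T) = \rank J.
  by apply/eqP; rewrite eqn_leq !mxrankS.
have J0 : \rank J = 1%N.
  rewrite rank_rV; have -> // : J != 0.
  by apply/eqP => /rowP/(_ ord0)/eqP; rewrite !mxE oner_eq0.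
have := row_leq_rank A; move/eqP: (rA) => ->.
move: rk; rewrite rJ J0; have : (#|T| <= n.+1)%N.
  by rewrite -{1}(eqP rA) rank_leq_col.
by clear; lia.
Qed.

Lemma counted_covered n (T F : graph n) : (0 < n)%N -> noncrossing T ->
  is_tree_on [set: 'I_n.+1] T -> noncrossing F -> alternating F ->
  F \subset transitive_closure T /\
    {in T, forall e, exists2 f, f \in F & covers T f e} <->
  counted_forest T #|F| F.
Proof.
move=> n0 nT tT nF aF; have [T0 s0 l0] := tree_extremes n0 tT.
have fT : full_subtree T T.
  apply: full_subtree_refl => //; case: tT => _ fT cT; split=> // x y _ _.
  by apply: cT; rewrite inE.
split=> [[FT cov]|[[_ FT _ _] _ _ cr cl]]; last first.
  by split=> //; apply: conditions_cover.
have cl := covered_left nT fT nF aF cov.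
have cr := covered_right nT fT nF aF cov.
split=> //; first by split=> //; apply: noncrossing_alternating_forest.
have [P sP] : exists P, is_path T ord0 ord_max P.
  have tT' : is_tree_on (vertices T) T by case: fT.
  have [P [i [j [hi hj hP]]]] := spine_exists tT' T0.
  by exists P; rewrite (smallest_uniq s0 hi) (largest_uniq l0 hj).
(* The spine of [T] is a left pseudo-component from the first to the last vertex, and nothing lies
   beyond the last, so the left condition already yields the edge (1,n+1). *)
have [|j1 [lej aj]] := cl ord0 ord_max.
  split; last by case=> s /arc_lt.
  split=> //; exists P => //; apply: pseudo_component_spine.
  by exists ord0, ord_max.
have -> : ord_max = j1 :> 'I_n.+1 by apply/val_inj/eqP; rewrite eqn_leq lej -ltnS ltn_ord.
by [].
Qed.

(** * Invariance under reduction *)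

Section Reduction.

Variables (n : nat) (eij ejk eik : edge n) (H : graph n).
Hypothesis triple : reducible_triple eij ejk eik.
Hypotheses (ijH : eij \notin H) (jkH : ejk \notin H).

Let G := eij |: (ejk |: H).

Hypothesis iG : independent int G.

Lemma reducible_triple_incidence (R : comNzRingType) x :
  incidence R eik x = incidence R eij x + incidence R ejk x.
Proof. by case: triple => h1 h2 h3; rewrite /incidence h1 h2 h3; ring. Qed.

Lemma reducible_triple_neq : [/\ eij != ejk, eik != eij & eik != ejk].
Proof.
case: triple => h1 h2 h3; have l1 := edge_lt eij; have l2 := edge_lt ejk.
split; apply/eqP => h.
- by move: l1; rewrite h1 -h ltnn.
- by move: l2; rewrite -h1 -h3 h ltnn.
- by move: l1; rewrite h1 -h2 h ltnn.
Qed.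

(** A multiple of the linear relation e_ij + e_jk - e_ik = 0. *)
Let z0 (R : comNzRingType) (c : R) (e : edge n) : R :=
  c * ((e == eij)%:R + (e == ejk)%:R - (e == eik)%:R).

Let netflow_z0 (R : comNzRingType) (c : R) x : netflow (z0 c) x = 0.
Proof.
rewrite /z0 netflowZ netflowB netflowD !netflow1 reducible_triple_incidence.
by ring.
Qed.

(** Otherwise [G] would contain the dependent edges ij, jk and ik. Hence a reduction never repeats a
    factor, and all monomials stay squarefree. *)
Lemma triple_notin : eik \notin H.
Proof.
have [n1 n2 n3] := reducible_triple_neq.
apply/negP => ikH; have zs e : e \notin G -> z0 (1 : int) e = 0.
  rewrite !inE !negb_or => /and3P[nei nej eH].
  rewrite /z0 (negPf nei) (negPf nej).
  by case: eqP => [ek|_]; [rewrite ek ikH in eH|rewrite /=; ring].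
have /eqP := iG zs (netflow_z0 1) eij.
by rewrite /z0 eqxx (negPf n1) [eij == _]eq_sym (negPf n2) mul1r addr0 subr0 oner_eq0.
Qed.

(** Adding [z eik] times the basic relation to a relation [z] on [H'] eliminates ik and leaves a
    relation on [G], which vanishes. Its value at the edge missing from [H'] is [z eik], so [z]
    itself vanishes. *)
Lemma reduction_independent (H' : graph n) : H' \subset eik |: G ->
  (eij \notin H') || (ejk \notin H') -> independent int H'.
Proof.
have [n1 n2 n3] := reducible_triple_neq.
move=> sub miss z zH zb.
pose zz e := z e + z0 (z eik) e.
have zz0 e : zz e = 0.
  apply: iG => [f|x]; last by rewrite netflowD netflow_z0 zb addr0.
  rewrite /zz /z0 => fG; have := fG.
  rewrite !inE !negb_or => /and3P[/negPf -> /negPf -> _].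
  case: eqP => [->|fk]; first by rewrite /=; ring.
  rewrite zH; first by rewrite /=; ring.
  apply: contra fG => /(subsetP sub) /setU1P[] //.
have zik : z eik = 0.
  case/orP: miss => miss.
    have := zz0 eij; rewrite /zz /z0 zH // eqxx (negPf n1) eq_sym (negPf n2).
    by move=> /= <-; ring.
  have := zz0 ejk; rewrite /zz /z0 zH // eqxx eq_sym (negPf n1) eq_sym (negPf n3).
  by move=> /= <-; ring.
by move=> e; rewrite -(zz0 e) /zz /z0 zik; ring.
Qed.

(* The substitution e_ik = e_ij + e_jk and its inverse. *)
Let expand (w : edge n -> nat) (e : edge n) : nat :=
  if e == eik then 0%N else (w e + ((e == eij) + (e == ejk)) * w eik)%N.

Let contract (w : edge n -> nat) (e : edge n) : nat :=
  if e == eik then minn (w eij) (w ejk)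
  else (w e - ((e == eij) + (e == ejk)) * minn (w eij) (w ejk))%N.

Let natflow_expand w : natflow (expand w) =1 natflow w.
Proof.
have [n1 n2 n3] := reducible_triple_neq.
move=> x; rewrite /natflow -[RHS]addr0 -(netflow_z0 (w eik)%:R x) -netflowD.
apply: eq_netflow => e; rewrite /expand /z0; case: (eqVneq e eik) => [->|nek].
  by rewrite (negPf n2) (negPf n3) /=; ring.
by rewrite natrD natrM natrD /=; ring.
Qed.

Let natflow_contract w : w eik = 0%N -> natflow (contract w) =1 natflow w.
Proof.
have [n1 n2 n3] := reducible_triple_neq.
move=> w0 x; pose c := minn (w eij) (w ejk).
rewrite /natflow -[LHS]addr0 -(netflow_z0 c%:R x) -netflowD.
apply: eq_netflow => e; rewrite /contract /z0 -/c.
case: (eqVneq e eik) => [->|nek].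
  by rewrite (negPf n2) (negPf n3) w0 /=; ring.
have ci : (c <= w eij)%N by apply: geq_minl.
have ck : (c <= w ejk)%N by apply: geq_minr.
case: (eqVneq e eij) => [->|nei].
  by rewrite (negPf n1) mul1n natrB // /=; ring.
case: (eqVneq e ejk) => [->|nej]; first by rewrite mul1n natrB // /=; ring.
by rewrite mul0n subn0 /=; ring.
Qed.

(** [expand] adds the weight of ik to both ij and jk, so whichever of the two was present becomes
    the larger one. [contract] moves the smaller weight onto ik and leaves exactly the larger edge,
    or neither when they are equal. *)
Lemma interior_reductionP u :
  [/\ interior (eik |: (eij |: H)) u <->
      exists2 w, support w = G /\ natflow w =1 natflow u & (w ejk < w eij)%N,
      interior (eik |: (ejk |: H)) u <->
      exists2 w, support w = G /\ natflow w =1 natflow u & (w eij < w ejk)%N &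
      interior (eik |: H) u <->
      exists2 w, support w = G /\ natflow w =1 natflow u & w eij = w ejk].
Proof.
have [n1 n2 n3] := reducible_triple_neq; have ikH := triple_notin.
have n1' : ejk != eij by rewrite eq_sym.
have n2' : eij != eik by rewrite eq_sym.
have n3' : ejk != eik by rewrite eq_sym.
have suppE (w : edge n -> nat) K : support w = K -> forall e, (0 < w e)%N = (e \in K).
  by move=> <- e; rewrite inE.
have up (w : edge n -> nat) (K : graph n) : support w = K -> eik \in K ->
    (forall e, e \notin [:: eij; ejk; eik] -> (e \in K) = (e \in H)) ->
    support (expand w) = G.
  move=> /suppE wK ikK KH; apply/setP => e; rewrite inE /expand !in_setU1.
  have wik : (0 < w eik)%N by rewrite wK.
  case: (eqVneq e eik) => [->|nek].
    by rewrite (negPf n2) (negPf n3) (negPf ikH).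
  case: (eqVneq e eij) => [->|nei]; first by rewrite addn_gt0 (negPf n1) mul1n wik orbT.
  case: (eqVneq e ejk) => [->|nej]; first by rewrite addn_gt0 mul1n wik orbT.
  rewrite mul0n addn0 wK KH //; by rewrite !inE !negb_or nei nej nek.
have down (w : edge n -> nat) (K : graph n) : support w = G -> eik \in K ->
    (eij \in K) = (w ejk < w eij)%N -> (ejk \in K) = (w eij < w ejk)%N ->
    (forall e, e \notin [:: eij; ejk; eik] -> (e \in K) = (e \in H)) ->
    support (contract w) = K.
  move=> /suppE wG ikK ijK jkK KH; apply/setP => e; rewrite inE /contract.
  case: (eqVneq e eik) => [->|nek].
    by rewrite ikK leq_min !wG !in_setU1 !eqxx orbT.
  case: (eqVneq e eij) => [->|nei].
    by rewrite (negPf n1) mul1n ijK; clear; lia.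
  case: (eqVneq e ejk) => [->|nej]; first by rewrite mul1n jkK; clear; lia.
  rewrite mul0n subn0 wG KH; first by rewrite !in_setU1 (negPf nei) (negPf nej).
  by rewrite !inE !negb_or nei nej nek.
have w0 (w : edge n -> nat) : support w = G -> w eik = 0%N.
  move=> wG; apply: notin_support; rewrite wG !in_setU1 (negPf n2) (negPf n3).
  by rewrite (negPf ikH).
have expE (w : edge n -> nat) : expand w eij = (w eij + w eik)%N /\
    expand w ejk = (w ejk + w eik)%N.
  rewrite /expand (negPf n2') (negPf n3') !eqxx (negPf n1) (negPf n1').
  by rewrite addn0 add0n mul1n.
split; split.
- case=> w wK bw; exists (expand w); first split.
  + apply: up wK _ _ => [|e]; rewrite !in_setU1 ?eqxx //.
    by rewrite !inE !negb_or => /and3P[/negPf -> _ /negPf ->].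
  + by move=> x; rewrite natflow_expand bw.
  + have [-> ->] := expE w; rewrite ltn_add2r.
    have /suppE wK' := wK; rewrite (_ : w ejk = 0%N); first by rewrite wK' !in_setU1 eqxx orbT.
    by apply: notin_support; rewrite wK !in_setU1 (negPf n3') (negPf n1').
- case=> w [wG bw] lt; exists (contract w); last by move=> x; rewrite natflow_contract ?bw // w0.
  apply: down => //; rewrite ?in_setU1 ?eqxx ?orbT ?lt //.
    by rewrite (negPf n3') (negPf n1') (negPf jkH); move: lt; clear; lia.
  move=> e; rewrite !inE !negb_or => /and3P[/negPf -> _ /negPf ->] //.
- case=> w wK bw; exists (expand w); first split.
  + apply: up wK _ _ => [|e]; rewrite !in_setU1 ?eqxx //.
    by rewrite !inE !negb_or => /and3P[_ /negPf -> /negPf ->].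
  + by move=> x; rewrite natflow_expand bw.
  + have [-> ->] := expE w; rewrite ltn_add2r.
    have /suppE wK' := wK; rewrite (_ : w eij = 0%N); first by rewrite wK' !in_setU1 eqxx orbT.
    by apply: notin_support; rewrite wK !in_setU1 (negPf n2') (negPf n1).
- case=> w [wG bw] lt; exists (contract w); last by move=> x; rewrite natflow_contract ?bw // w0.
  apply: down => //; rewrite ?in_setU1 ?eqxx ?orbT ?lt //.
    by rewrite (negPf n2') (negPf n1) (negPf ijH); move: lt; clear; lia.
  move=> e; rewrite !inE !negb_or => /and3P[_ /negPf -> /negPf ->] //.
- case=> w wK bw; exists (expand w); first split.
  + apply: up wK _ _ => [|e]; rewrite !in_setU1 ?eqxx //.
    by rewrite !inE !negb_or => /and3P[_ _ /negPf ->].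
  + by move=> x; rewrite natflow_expand bw.
  + have [-> ->] := expE w; congr (_ + _)%N.
    rewrite !notin_support // wK in_setU1 ?(negPf n3') ?(negPf jkH) //.
    by rewrite (negPf n2') (negPf ijH).
- case=> w [wG bw] eq; exists (contract w); last by move=> x; rewrite natflow_contract ?bw // w0.
  apply: down => //; rewrite ?in_setU1 ?eqxx ?orbT ?eq ?ltnn //.
  + by rewrite (negPf n2') (negPf ijH).
  + by rewrite (negPf n3') (negPf jkH).
  + move=> e; rewrite !inE !negb_or => /and3P[_ _ /negPf ->] //.
Qed.

(** Independence makes the weight on [G] unique, so exactly one of the three comparisons of its
    values at ij and jk holds. *)
Lemma interior_reduction u :
  `[< interior G u >] = (`[< interior (eik |: (eij |: H)) u >] +
    `[< interior (eik |: (ejk |: H)) u >] + `[< interior (eik |: H) u >])%N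
  :> nat.
Proof.
have [r1 r2 r3] := interior_reductionP u.
have [[w wG bw]|noG] := pselect (interior G u); last first.
  rewrite !asboolF //.
  - by move/r3 => [w [wG bw] _]; apply: noG; exists w.
  - by move/r2 => [w [wG bw] _]; apply: noG; exists w.
  - by move/r1 => [w [wG bw] _]; apply: noG; exists w.
have uniq (v : edge n -> nat) : support v = G /\ natflow v =1 natflow u -> v =1 w.
  move=> [vG bv]; apply: (independent_natflow iG); rewrite ?vG ?wG //.
  by move=> x; rewrite bv bw.
rewrite (asboolT (ex_intro2 _ _ w wG bw)).
have [lt|lt|eq] := ltngtP (w ejk) (w eij).
- rewrite (asboolT (r1.2 _)); last by exists w.
  rewrite !asboolF // => [/r3[v /uniq vw]|/r2[v /uniq vw]]; rewrite !vw.
    by move=> eq; rewrite eq ltnn in lt.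
  by move=> lt'; have := ltn_trans lt lt'; rewrite ltnn.
- rewrite (asboolT (r2.2 _)); last by exists w.
  rewrite !asboolF // => [/r3[v /uniq vw]|/r1[v /uniq vw]]; rewrite !vw.
    by move=> eq; rewrite eq ltnn in lt.
  by move=> lt'; have := ltn_trans lt lt'; rewrite ltnn.
- rewrite (asboolT (r3.2 _)); last by exists w.
  by rewrite !asboolF // => [/r2[v /uniq vw]|/r1[v /uniq vw]]; rewrite !vw eq ltnn.
Qed.

End Reduction.

(** * Squarefree monomials and the invariant of reduction *)

Definition graph_mnm n (G : graph n) : 'X_{1..#|{: edge n}|} :=
  (\sum_(e in G) U_(enum_rank e))%MM.

Lemma graph_monomialE n (G : graph n) : graph_monomial G = 'X_[graph_mnm G].
Proof. by rewrite /graph_monomial /graph_mnm -mprodXE. Qed.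

Lemma graph_mnmE n (G : graph n) e : graph_mnm G (enum_rank e) = (e \in G).
Proof.
rewrite /graph_mnm mnm_sumE; under eq_bigr do rewrite mnm1E (inj_eq enum_rank_inj).
have [eG|eG] := boolP (e \in G).
  by rewrite (bigD1 e) //= eqxx big1 // => f /andP[_ /negPf ->].
by apply: big1 => f fG; case: eqP => // fe; rewrite -fe fG in eG.
Qed.

Lemma graph_mnm_inj n : injective (@graph_mnm n).
Proof.
move=> G H h; apply/setP => e; have := graph_mnmE G e.
by rewrite h graph_mnmE; case: (e \in G); case: (e \in H).
Qed.

Lemma graph_mnmU n (G : graph n) e : e \notin G ->
  graph_mnm (e |: G) = (U_(enum_rank e) + graph_mnm G)%MM.
Proof. by move=> eG; rewrite /graph_mnm big_setU1. Qed.

Lemma graph_monomialU n (G : graph n) e : e \notin G ->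
  graph_monomial (e |: G) = xvar e * graph_monomial G.
Proof. by move=> eG; rewrite /graph_monomial big_setU1. Qed.

(* By homogeneity, the graph G occurs in a polynomial obtained from m[T] with
   the power beta^(n - |G|). *)
Definition graph_poly n (c : graph n -> nat) : xpoly n :=
  \sum_G ((c G)%:R * 'X^(n - #|G|)) *: graph_monomial G.

Lemma graph_polyD n (c c' : graph n -> nat) :
  graph_poly (fun G => c G + c' G)%N = graph_poly c + graph_poly c'.
Proof.
rewrite /graph_poly -big_split; apply: eq_bigr => G _.
by rewrite natrD mulrDl scalerDl.
Qed.

Lemma graph_poly1 n (G : graph n) :
  graph_poly (fun K => (K == G) : nat) = 'X^(n - #|G|) *: graph_monomial G.
Proof.
rewrite /graph_poly (bigD1 G) //= eqxx mul1r big1 ?addr0 // => K /negPf ->.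
by rewrite mul0r scale0r.
Qed.

Lemma eq_graph_poly n (c c' : graph n -> nat) :
  c =1 c' -> graph_poly c = graph_poly c'.
Proof. by move=> h; apply: eq_bigr => G _; rewrite h. Qed.

Lemma mcoeff_graph_poly n (c : graph n -> nat) G :
  (graph_poly c)@_(graph_mnm G) = (c G)%:R * 'X^(n - #|G|).
Proof.
rewrite /graph_poly raddf_sum (bigD1 G) //= mcoeffZ graph_monomialE mcoeffX.
rewrite eqxx mulr1 big1 ?addr0 // => K KG.
by rewrite mcoeffZ graph_monomialE mcoeffX (inj_eq (@graph_mnm_inj n)) (negPf KG) mulr0.
Qed.

Lemma mcoeff_graph_poly_neq0 n (c : graph n -> nat) m :
  (graph_poly c)@_m != 0 -> exists G, m = graph_mnm G.
Proof.
move=> h; apply: contrapT => noG; move/eqP: h; apply.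
rewrite /graph_poly raddf_sum big1 //= => G _.
rewrite mcoeffZ graph_monomialE mcoeffX; case: eqP => [e|_]; last by rewrite mulr0.
by case: noG; exists G.
Qed.

Lemma meval1_graph_poly n (c : graph n -> nat) :
  (graph_poly c).@[fun=> 1] = \sum_G (c G)%:R * 'X^(n - #|G|).
Proof.
rewrite /graph_poly raddf_sum; apply: eq_bigr => G _ /=.
rewrite mevalZ graph_monomialE mevalX big1 ?mulr1 // => i _.
by rewrite expr1n.
Qed.

(** The invariant of reduction: [c] is a multiset of graphs whose cones share out the interior
    points of the cone of [T]. The bound on [#|G|] keeps the exponent [n - #|G|] from being
    truncated. *)
Definition expansion n (T : graph n) (p : xpoly n) : Prop :=
  exists c : graph n -> nat, [/\ p = graph_poly c,
    forall G, (0 < c G)%N -> independent int G /\ (#|G| <= n)%N &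
    forall u : edge n -> nat,
      (\sum_G c G * `[< interior G u >] = `[< interior T u >])%N].

Lemma sum_nat_delta (I : finType) (i : I) (F : I -> nat) :
  (\sum_k (k == i) * F k = F i)%N.
Proof.
rewrite (bigD1 i) //= eqxx mul1n big1 ?addn0 // => k /negPf ->.
by rewrite mul0n.
Qed.

Lemma reduction_expansion n (T : graph n) p q :
  expansion T p -> reduction_step p q -> expansion T q.
Proof.
move=> [c [-> indc sumc]] [a [m [eij [ejk [eik [triple pos ->]]]]]].
have [n1 n2 n3] := reducible_triple_neq triple.
have nz : (graph_poly c)@_(U_(enum_rank eij) + U_(enum_rank ejk) + m)%MM != 0.
  by apply: contraTneq pos => ->; rewrite coef0 Order.PreorderTheory.ltxx.
(* A positive coefficient forces the rewritten monomial to be that of a graph [G] with [0 < c G],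
   and the power of beta to be the one that goes with [G]. *)
have [G hG] := mcoeff_graph_poly_neq0 nz.
move: pos; rewrite hG mcoeff_graph_poly mulr_natl coefMn coefXn => pos.
have cG : (0 < c G)%N.
  by rewrite lt0n; apply: contraTneq pos => ->; rewrite mulr0n Order.PreorderTheory.ltxx.
have {pos} ha : a = (n - #|G|)%N.
  by apply/eqP; apply: contraTT pos => /negPf ->; rewrite mul0rn Order.PreorderTheory.ltxx.
have [iG cardG] := indc G cG.
have inG e : (0 < (U_(enum_rank eij) + U_(enum_rank ejk) + m)%MM (enum_rank e))%N ->
    e \in G by rewrite hG graph_mnmE lt0b.
have ijG : eij \in G by apply: inG; rewrite !mnmDE mnm1E eqxx.
have jkG : ejk \in G.
  by apply: inG; rewrite !mnmDE [X in (_ + X + _)%N]mnm1E eqxx addn1.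
pose H := G :\ eij :\ ejk.
have jkH : ejk \notin H by rewrite !inE eqxx.
have ijH : eij \notin H by rewrite !inE eqxx andbF.
have ijH' : eij \notin ejk |: H by rewrite in_setU1 negb_or n1.
have defG : G = eij |: (ejk |: H).
  by rewrite /H setD1K ?setD1K // !inE eq_sym n1.
have {hG inG} hm : m = graph_mnm H.
  move: hG; rewrite defG !graph_mnmU // addmA; exact: addmI.
rewrite defG in iG cardG ha.
have ikH := triple_notin triple iG.
set G1 := eik |: (eij |: H); set G2 := eik |: (ejk |: H); set G3 := eik |: H.
have ikG1 : eik \notin eij |: H by rewrite in_setU1 negb_or n2.
have ikG2 : eik \notin ejk |: H by rewrite in_setU1 negb_or n3.
have card1 : #|G1| = #|G| by rewrite defG !cardsU1 ikG1 ijH' ijH jkH.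
have card2 : #|G2| = #|G| by rewrite defG !cardsU1 ikG2 ijH' jkH.
have card3 : #|G| = #|G3|.+1 by rewrite defG !cardsU1 ikH ijH' jkH.
rewrite -defG in iG cardG ha.
(* Only one copy of [G] is rewritten; [c0] keeps the others. *)
pose c0 K := (c K - (K == G))%N.
have hc : c =1 (fun K => c0 K + (K == G))%N.
  by move=> K; rewrite /c0; case: eqP => [->|_]; [rewrite subnK|rewrite subn0 addn0].
exists (fun K => c0 K + (K == G1) + (K == G2) + (K == G3))%N; split.
- rewrite (eq_graph_poly hc) !graph_polyD !graph_poly1 card1 card2.
  rewrite (congr1 (@graph_monomial n) defG) hm -graph_monomialE !graph_monomialU //.
  (* The third graph has one edge fewer, which accounts for the factor beta in the rule. *)
  have -> : 'X^(n - #|G3|) = 'X * 'X^(n - #|G|) :> {poly int}.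
    by rewrite -exprS; congr ('X^ _); move: card3 cardG; clear; lia.
  rewrite -!mul_mpolyC -ha /beta mpolyCM !rmorphXn /=.
  move: ('X%:MP_[_] ^+ a) => ba; move: 'X%:MP_[_] (graph_monomial H) => b M.
  by move: (xvar eij) (xvar ejk) (xvar eik) (graph_poly c0) => x y z r; ring.
- move=> K; have := indc K; rewrite /c0; case: (eqVneq K G1) => [->|nK1].
    move=> _ _; rewrite card1; split=> //; rewrite defG in iG.
    apply: (reduction_independent triple iG); last first.
      by rewrite orbC !in_setU1 !negb_or jkH eq_sym n3 eq_sym n1.
    by apply: setUS; apply: setUS; apply: subsetUr.
  case: (eqVneq K G2) => [->|nK2].
    move=> _ _; rewrite card2; split=> //; rewrite defG in iG.
    apply: (reduction_independent triple iG); last first.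
      by rewrite !in_setU1 !negb_or ijH eq_sym n2 n1.
    by apply: setUS; apply: subsetUr.
  case: (eqVneq K G3) => [->|nK3].
    move=> _ _; split; last by rewrite ltnW // -card3.
    rewrite defG in iG; apply: (reduction_independent triple iG).
      by apply: setUS; rewrite setUA; apply: subsetUr.
    by rewrite !in_setU1 !negb_or ijH eq_sym n2.
  by rewrite !addn0 => h hK; apply: h; move: hK; clear; lia.
- move=> u; rewrite -sumc; have iG' := iG; rewrite defG in iG'.
  under eq_bigr do rewrite !mulnDl.
  under [RHS]eq_bigr do rewrite hc mulnDl.
  rewrite !big_split /= !sum_nat_delta -!addnA; congr (_ + _)%N.
  by rewrite [X in _ = nat_of_bool `[< interior X u >]]defG (interior_reduction triple ijH jkH iG') addnA.
Qed.

Lemma expansion_graph_monomial n (T : graph n) : independent int T ->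
  #|T| = n -> expansion T (graph_monomial T).
Proof.
move=> iT cT; exists (fun K => (K == T) : nat); split.
- by rewrite graph_poly1 cT subnn expr0 scale1r.
- by move=> G; rewrite lt0b => /eqP ->; rewrite cT.
- by move=> u; rewrite sum_nat_delta.
Qed.

Lemma reduced_form_expansion n (T : graph n) p : independent int T ->
  #|T| = n -> clos_refl_trans (xpoly n) (@reduction_step n) (graph_monomial T) p ->
  expansion T p.
Proof.
move=> iT cT red; have := expansion_graph_monomial iT cT.
elim: red => {p} [p q pq ep|//|p q r _ IH1 _ IH2 /IH1/IH2 //].
exact: reduction_expansion ep pq.
Qed.

Lemma irreducible_alternating n (c : graph n -> nat) G :
  irreducible_xpoly (graph_poly c) -> (0 < c G)%N -> alternating G.
Proof.
move=> irr cG; apply/alternating_edges => e f eG fG ef.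
have lt : (src e < tgt f)%N.
  by apply: ltn_trans (edge_lt e) _; rewrite ef edge_lt.
apply: (irr e f (mkedge lt) (graph_mnm G)); first by split.
  rewrite mcoeff_msupp mcoeff_graph_poly; apply/eqP => /polyP/(_ (n - #|G|)%N).
  rewrite mulr_natl coefMn coefXn eqxx coef0 => /eqP.
  by rewrite Num.Theory.pnatr_eq0 eqn0Ngt cG.
have nef : e != f by apply/eqP => h; have := edge_lt e; rewrite ef h ltnn.
apply/mnm_lepP => i; rewrite -(enum_valK i) graph_mnmE mnmDE !mnm1E.
rewrite !(inj_eq enum_rank_inj); case: (eqVneq e (enum_val i)) => [<-|ne].
  by rewrite eG eq_sym (negPf nef).
by case: (eqVneq f (enum_val i)) => [<-|//]; rewrite fG.
Qed.

(** * Counting lattice points by degree *)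

Lemma card_le_rel (A : finType) (X Y : {set A}) (r : A -> A -> Prop) :
  {in X, forall x, exists2 y, y \in Y & r x y} ->
  {in X &, forall x x' , forall y, r x y -> r x' y -> x = x'} ->
  (#|X| <= #|Y|)%N.
Proof.
move=> tot inj.
have /choice[f hf] x : exists y, x \in X -> y \in Y /\ r x y.
  have [xX|xX] := boolP (x \in X); last by exists x.
  by have [y yY rxy] := tot x xX; exists y.
have finj : {in X &, injective f}.
  move=> x x' xX x'X h; apply: (inj x x' xX x'X (f x)); first exact: (hf x xX).2.
  by rewrite h; apply: (hf x' x'X).2.
rewrite -(card_in_imset finj); apply: subset_leq_card.
by apply/subsetP => _ /imsetP[x xX ->]; apply: (hf x xX).1.
Qed.

(** In total degree d no weight exceeds d, so these weights form a finite type. *)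
Definition bounded n (d : nat) := {ffun edge n -> 'I_d.+1}.

Definition weights n d (u : bounded n d) (e : edge n) : nat := u e.

Definition of_degree n d (F : graph n) : {set bounded n d} :=
  [set u | (support (weights u) == F) && (\sum_e weights u e == d)%N].

(** Stands for the set of lattice points of degree d: each has exactly one such weight. *)
Definition parenthesizations n d : {set bounded n d} :=
  [set u | `[< noncrossing (support (weights u)) /\
               alternating (support (weights u)) >]
           && (\sum_e weights u e == d)%N].

Lemma weights_inj n d (u v : bounded n d) : weights u =1 weights v -> u = v.
Proof. by move=> h; apply/ffunP => e; apply/val_inj/h. Qed.

Lemma weights_exists n d (w : edge n -> nat) : (\sum_e w e = d)%N ->
  exists u : bounded n d, weights u =1 w.
Proof.
move=> hd; exists [ffun e => inord (w e)] => e; rewrite /weights ffunE inordK //.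
by rewrite ltnS -hd (bigD1 e) //= leq_addr.
Qed.

Lemma degree_natflow n (w w' : edge n -> nat) :
  alternating (support w) -> alternating (support w') ->
  natflow w =1 natflow w' -> (\sum_e w e = \sum_e w' e)%N.
Proof.
move=> aw aw' h; rewrite !total_outflow; apply: eq_bigr => x _.
by have [] := alternating_flow_eq aw aw' (h x).
Qed.

(** Equality of flows matches the two sets: representatives are unique on one side, and weights on
    [G] are unique by independence on the other. Alternation of [G] ensures that matched weights
    have the same degree. *)
Lemma card_interior_alternating n d (G : graph n) : independent int G ->
  alternating G ->
  #|[set u in parenthesizations n d | `[< interior G (weights u) >]]| =
  #|of_degree d G|.
Proof.
move=> iG aG; apply/eqP; rewrite eqn_leq; apply/andP; split.
  apply: (@card_le_rel _ _ _ (fun u w => natflow (weights u) =1 natflow (weights w))).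
    move=> u; rewrite !inE => /andP[/andP[/asboolP[nu au] /eqP du] /asboolP[w wG bw]].
    have [|v hv] := @weights_exists n d w.
      by rewrite -du; apply: degree_natflow; rewrite ?wG.
    exists v; last by move=> x; rewrite -bw (eq_natflow hv).
    rewrite inE (eq_support hv) wG eqxx; apply/eqP; rewrite -[RHS]du.
    rewrite (eq_bigr _ (fun e _ => hv e)).
    by apply: degree_natflow; rewrite ?wG.
  move=> u u'; rewrite !inE => /andP[/andP[/asboolP[nu au] _] _].
  move=> /andP[/andP[/asboolP[nu' au'] _] _] v h h'; apply: weights_inj.
  by apply: noncrossing_alternating_unique => // x; rewrite h h'.
apply: (@card_le_rel _ _ _ (fun w u => natflow (weights w) =1 natflow (weights u))).
  move=> w; rewrite inE => /andP[/eqP wG /eqP dw].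
  have closed : closed_under_uncrossing [set: edge n].
    have full (i j : 'I_n.+1) : (i < j)%N -> arc [set: edge n] i j.
      by move=> ij; apply/arcP; exists (mkedge ij).
    split=> [i j k /arc_lt ij /arc_lt jk|i j k l ij jk kl _ _].
      by apply: full; apply: ltn_trans jk.
    by split; apply: full => //; apply: ltn_trans kl; apply: ltn_trans jk.
  have [u [_ nu au bu]] := noncrossing_alternating_exists closed (subsetT (support (weights w))).
  have [|v hv] := @weights_exists n d u.
    by rewrite -dw; apply: degree_natflow; rewrite ?wG.
  have bv : natflow (weights w) =1 natflow (weights v).
    by move=> x; rewrite (eq_natflow hv) bu.
  exists v => //; rewrite !inE (eq_support hv); apply/andP; split; last first.
    by apply/asboolP; exists (weights w).
  apply/andP; split; first exact/asboolP.
  apply/eqP; rewrite -[RHS]dw; apply/esym/degree_natflow; rewrite ?wG //.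
  by rewrite (eq_support hv).
move=> w w'; rewrite !inE => /andP[/eqP wG _] /andP[/eqP w'G _] u h h'.
apply: weights_inj; apply: (independent_natflow iG); rewrite ?wG ?w'G //.
by move=> x; rewrite h h'.
Qed.

Lemma card_interior_tree n d (T : graph n) : (0 < n)%N -> noncrossing T ->
  is_tree_on [set: 'I_n.+1] T ->
  #|[set u in parenthesizations n d | `[< interior T (weights u) >]]| =
  (\sum_(F : graph n) `[< counted_forest T #|F| F >] * #|of_degree d F|)%N.
Proof.
move=> n0 nT tT; have iT : independent int T.
  by case: tT => _ fT _; apply: forest_independent.
rewrite -sum1_card (partition_big (fun u : bounded n d => support (weights u)) xpredT) //=.
apply: eq_bigr => F _; rewrite sum1dep_card.
have [cF|ncF] := boolP `[< counted_forest T #|F| F >]; last first.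
  rewrite mul0n; apply/eqP; rewrite cards_eq0; apply/eqP/setP => u.
  rewrite !inE; apply/negP => /andP[/andP[/andP[/asboolP[nu au] _] /asboolP iu] /eqP uF].
  case/negP: ncF; apply/asboolP; rewrite -uF.
  by apply/(counted_covered n0 nT tT nu au)/interior_covered.
rewrite mul1n; apply: eq_card => u; rewrite !inE.
have [uF|] := eqVneq (support (weights u)) F; last by rewrite andbF.
rewrite andbT /=; case: eqP => [_|]; last by rewrite andbF.
move/asboolP: cF => cF; have [[_ _ nF aF] _ _ _ _] := cF.
rewrite andbT uF; apply/andP; split; apply/asboolP; first by [].
apply/(interior_covered nT iT); rewrite uF //.
exact/(counted_covered n0 nT tT nF aF).
Qed.

(** The number of ways to write d as an ordered sum of k positive integers, binomial(d-1,k-1) for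
    positive k and d. Exponents above d cannot contribute, so the geometric series is cut there. *)
Definition simplex_count (k d : nat) : int :=
  ((\sum_(t < d.+1 | (0 < t)%N) 'X^t) ^+ k : {poly int})`_d.

Lemma card_of_degree n d (F : graph n) :
  #|of_degree d F|%:R = simplex_count #|F| d.
Proof.
pose Q (e : edge n) : pred 'I_d.+1 := fun t => (0 < t)%N == (e \in F).
have -> : simplex_count #|F| d =
    (\prod_e \sum_(t | Q e t) ('X^t : {poly int}))`_d.
  rewrite /simplex_count -prodr_const [in RHS](bigID (mem F)) /=.
  rewrite [X in _ * X]big1 ?mulr1 => [|e eF].
    apply: (congr1 (fun p : {poly int} => p`_d)).
    apply: eq_bigr => e eF; apply: eq_bigl => t.
    by rewrite /Q (eF : e \in F) eqb_id.
  rewrite (big_pred1 ord0) ?expr0 // => t.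
  by rewrite /Q (negPf eF) eqbF_neg -leqNgt leqn0.
rewrite bigA_distr_big_dep coef_sum -sum1_card natr_sum.
rewrite big_mkcond [RHS]big_mkcond; apply: eq_bigr => u _.
have -> : (u \in family Q) = (support (weights u) == F).
  apply/familyP/eqP => [h|uF e]; last by rewrite unfold_in /Q -uF inE.
  by apply/setP => e; rewrite inE; have := h e; rewrite unfold_in /Q => /eqP.
rewrite inE; case: (support (weights u) == F) => //=.
by rewrite -expr_sum coefXn eq_sym; case: eqP.
Qed.

Lemma simplex_count_gt k d : (d < k)%N -> simplex_count k d = 0.
Proof.
move=> dk; rewrite /simplex_count big_mkcond big_ord_recl /= add0r.
under eq_bigr do rewrite /bump /= add1n exprS.
by rewrite -mulr_sumr exprMn coefXnM dk.
Qed.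

Lemma simplex_count_diag k : simplex_count k k = 1.
Proof.
rewrite /simplex_count big_mkcond big_ord_recl /= add0r.
under eq_bigr do rewrite /bump /= add1n exprS.
rewrite -mulr_sumr exprMn coefXnM ltnn subnn; case: k => [|k].
  by rewrite expr0 coef1.
rewrite big_ord_recl expr0 -horner_coef0 horner_exp hornerD hornerC.
rewrite horner_sum big1 ?addr0 ?expr1n // => t _.
by rewrite hornerXn expr0n.
Qed.

(* The matrix simplex_count is unitriangular. *)
Lemma level_sums_eq (I : finType) (h : I -> nat) (a b : I -> int) :
  (forall d, \sum_i a i * simplex_count (h i) d =
             \sum_i b i * simplex_count (h i) d) ->
  forall k, \sum_(i | h i == k) a i = \sum_(i | h i == k) b i.
Proof.
move=> ab; pose c i := a i - b i.
have c0 d : \sum_i c i * simplex_count (h i) d = 0.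
  under eq_bigr do rewrite mulrBl.
  by rewrite sumrB ab subrr.
suff ck k : \sum_(i | h i == k) c i = 0.
  by move=> k; apply/eqP; rewrite -subr_eq0 -sumrB; apply/eqP/ck.
have [m] := ubnP k; elim: m k => // m IH k km.
(* Levels below k already have zero sum by induction, so they drop out in every degree. *)
have low d l : (l <= k)%N -> \sum_(i | (h i < l)%N) c i * simplex_count (h i) d = 0.
  elim: l => [|l IHl] lk; first by rewrite big_pred0.
  rewrite (bigID (fun i => h i == l)) /= [X in X + _](_ : _ = 0) ?add0r.
    rewrite -[RHS](IHl (ltnW lk)); apply: eq_bigl => i; rewrite ltnS leq_eqVlt.
    by case: eqVneq => [->|]; rewrite ?ltnn ?andbF ?andbT.
  transitivity (\sum_(i | h i == l) c i * simplex_count l d).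
    apply: eq_big => [i|i /andP[_ /eqP -> //]].
    by case: eqVneq => [->|]; rewrite ?leqnn ?andbF.
  by rewrite -mulr_suml IH ?mul0r //; apply: leq_trans lk _; rewrite -ltnS.
(* In degree k the levels above k vanish and level k has coefficient 1. *)
have := c0 k; rewrite (bigID (fun i => (h i < k)%N)) /= low // add0r.
rewrite (bigID (fun i => h i == k)) /= [X in _ + X]big1 ?addr0 => [|i /andP[h1 h2]].
  move=> e; rewrite -[RHS]e; apply: eq_big => [i|i /eqP ->]; last by rewrite simplex_count_diag mulr1.
  by case: eqVneq => [->|]; rewrite ?ltnn ?andbF.
by rewrite simplex_count_gt ?mulr0 // ltn_neqAle eq_sym h2 leqNgt.
Qed.

(** Counting the degree-d interior points of the cone of [T] in both ways gives equal sums against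
    [simplex_count] for every d, and unitriangularity then separates the levels. *)
Lemma expansion_level n (T : graph n) (c : graph n -> nat) : (0 < n)%N ->
  noncrossing T -> is_tree_on [set: 'I_n.+1] T ->
  (forall G, (0 < c G)%N -> independent int G /\ alternating G) ->
  (forall u : edge n -> nat,
      (\sum_G c G * `[< interior G u >] = `[< interior T u >])%N) ->
  forall k, (\sum_(G : graph n | #|G| == k) c G = num_forests T k)%N.
Proof.
move=> n0 nT tT hc sumc k.
pose phi (F : graph n) : nat := `[< counted_forest T #|F| F >].
have -> : num_forests T k = (\sum_(F : graph n | #|F| == k) phi F)%N.
  rewrite /num_forests -sum1_card big_mkcond [RHS]big_mkcond /=.
  apply: eq_bigr => F _; rewrite inE; case: eqVneq => [<-|Fk].
    by rewrite /phi; case: asboolP.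
  by rewrite asboolF // => -[_ /eqP]; rewrite (negPf Fk).
have inj_int (x y : nat) : (x%:R = y%:R :> int) -> x = y by rewrite !natz => -[].
apply: inj_int; rewrite !natr_sum; apply: level_sums_eq => d.
have levels (f : graph n -> nat) :
    \sum_(F : graph n) (f F)%:R * simplex_count #|F| d =
    (\sum_(F : graph n) f F * #|of_degree d F|)%N%:R.
  by rewrite natr_sum; apply: eq_bigr => F _; rewrite natrM card_of_degree.
rewrite !levels; congr (_%:R).
rewrite -(card_interior_tree d n0 nT tT).
have cardE (Z : graph n) :
    #|[set u in parenthesizations n d | `[< interior Z (weights u) >]]| =
    (\sum_(u in parenthesizations n d) `[< interior Z (weights u) >])%N.
  rewrite -sum1_card big_mkcond [RHS]big_mkcond; apply: eq_bigr => u _.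
  by rewrite inE; case: (u \in _) => //=; case: `[< _ >].
rewrite cardE; under [RHS]eq_bigr do rewrite -sumc.
rewrite exchange_big; apply: eq_bigr => G _ /=; rewrite -big_distrr /= -cardE.
have [cG|] := posnP (c G); first by rewrite cG.
by move/hc => [iG aG]; rewrite card_interior_alternating.
Qed.

Theorem theorem2 (n : nat) (hn : (1 <= n)%N)
    (T : graph n) (lab : edge n -> nat) (hT : good_tree T lab)
    (P : xpoly n) (hP : reduced_form (graph_monomial T) P) :
  P.@[fun=> 1] =
    \sum_(0 <= m < n) (num_forests T (n - m))%:R * 'X^m :> {poly int}.
Proof.
have [[fT _ [_ _ _ nT]] tT] := hT.
have iT : independent int T := forest_independent fT.
have cardT := card_tree tT.
have [red irr] := hP.
have [c [defP hc sumc]] := reduced_form_expansion iT cardT red.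
rewrite defP in irr.
have level := @expansion_level n T c hn nT tT.
have {}level k : (\sum_(G : graph n | #|G| == k) c G = num_forests T k)%N.
  apply: level => // G cG; split; first by have [] := hc G cG.
  exact: irreducible_alternating irr cG.
(* A counted forest contains (1,n+1), so it has an edge; this removes the term m = n from the
   sum. *)
have level0 : num_forests T 0 = 0%N.
  apply/eqP; rewrite cards_eq0; apply/eqP/setP => F; rewrite !inE.
  apply/asboolP => -[_ /eqP]; rewrite cards_eq0 => /eqP -> /arcP[e].
  by rewrite inE.
rewrite defP meval1_graph_poly.
transitivity (\sum_(0 <= m < n.+1) (num_forests T (n - m))%:R * 'X^m :> {poly int}).
  rewrite big_mkord.
  transitivity (\sum_(G : graph n) \sum_(m < n.+1)
      (if (n - #|G|)%N == m then (c G)%:R * 'X^m else 0) :> {poly int}).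
    apply: eq_bigr => G _.
    have lt : (n - #|G| < n.+1)%N by rewrite ltnS leq_subr.
    rewrite (bigD1 (Ordinal lt)) //= eqxx big1 ?addr0 // => m.
    by rewrite -val_eqE /= eq_sym => /negPf ->.
  rewrite exchange_big; apply: eq_bigr => m _.
  rewrite -level natr_sum mulr_suml [RHS]big_mkcond; apply: eq_bigr => G _ /=.
  (* The bound [#|G| <= n], needed to invert m = n - #|G|, is known only for graphs that occur; the
     others contribute zero on both sides. *)
  have [cG|/hc[_ leG]] := posnP (c G).
    by rewrite cG mul0r; case: ifP => _; case: ifP.
  have lem : (m <= n)%N by rewrite -ltnS ltn_ord.
  suff -> : ((n - #|G|)%N == m) = (#|G| == n - m)%N by [].
  by apply/eqP/eqP => [<-|->]; rewrite subKn.
by rewrite big_nat_recr //= subnn level0 mul0r addr0.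
Qed.
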